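(* On $F(5)=\mathrm{SU}(5)/T^4$ consider the invariant metric, in the order $(x_{12},x_{13},x_{14},x_{15},x_{23},x_{24},x_{25},x_{34},x_{35},x_{45})$, $$g_3=\left(-\tfrac{3967}{5}+237K-\tfrac{87}{5}K^2,\,K,K,K,K,K,K,\,Z,Z,Z\right),\qquad Z=\tfrac{41}{5}K^2-\tfrac{227}{2}K+\tfrac{3967}{10},$$ where $K\approx 7.4806$ is the positive real root of $P(x)=14x^3-277x^2+1819x-3967$. Then $g_3$ is Einstein, with Einstein constant $\rho$ satisfying $2\rho=\tfrac1{10}$ (where $\mathrm{Rc}(g_3)=\rho g_3$), it is $G$-non-degenerate and $G$-unstable, and its coindex is $5$.
   Context: $F(n)=\mathrm{SU}(n)/T^{n-1}$, where $T=T^{n-1}$ is the diagonal maximal torus with Lie algebra $\mathfrak{t}$; $G=\mathrm{SU}(n)$. Let $Q=-B$ be minus the Killing form of $\mathfrak{su}(n)$. There is a $Q$-orthogonal decomposition $\mathfrak{su}(n)=\mathfrak{t}\oplus\bigoplus_{1\le i<j\le n}\mathfrak{p}_{ij}$, where $\mathfrak{p}_{ij}$ is the 2-dimensional space of skew-Hermitian matrices whose only nonzero entries are in positions $(i,j)$ and $(j,i)$; the $\mathfrak{p}_{ij}$ are irreducible and pairwise inequivalent under $\mathrm{Ad}(T)$. Hence every $G$-invariant metric on $F(n)$ is determined by $g=\sum_{i<j}x_{ij}\,Q|_{\mathfrak{p}_{ij}}$ on $\mathfrak{p}=\bigoplus\mathfrak{p}_{ij}\cong T_oF(n)$ with $x_{ij}>0$,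 and is denoted by the tuple $(x_{ij})$ in lexicographic order. Stability notions. Let $\mathcal M_1^G$ be the manifold of unit-volume $G$-invariant metrics. A metric $g\in\mathcal M_1^G$ is Einstein ($\mathrm{Rc}(g)=\rho g$) iff it is a critical point of the scalar curvature functional $\mathrm{Sc}:\mathcal M_1^G\to\mathbb R$. Let $\mathrm{Sc}''_g$ be the Hessian at such $g$, restricted to the space $\mathcal{TT}_g^G$ of $G$-invariant traceless divergence-free symmetric 2-tensors (here equal to $T_g\mathcal M_1^G$, the $G$-invariant $g$-traceless symmetric 2-tensors). The Einstein metric $g$ is $G$-unstable if $\mathrm{Sc}''_g(T,T)>0$ for some $T\in\mathcal{TT}_g^G$, and $G$-non-degenerate if $\mathrm{Sc}''_g|_{\mathcal{TT}_g^G}$ is non-degenerate; its coindex is the maximal dimension of a subspace of $\mathcal{TT}_g^G$ on which $\mathrm{Sc}''_g$ is positive definite. For Einstein metrics not of unit volume, these notions refer to the unit-volume rescaling. *)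

(* Defs.v *)
From HB Require Import structures.
From mathcomp Require Import all_boot all_order all_algebra.
From mathcomp Require Import boolp classical_sets reals topology normedtype.
From mathcomp Require Import derive complex.

Set Implicit Arguments.
Unset Strict Implicit.
Unset Printing Implicit Defensive.

Import Order.TTheory GRing.Theory Num.Theory.
Import numFieldNormedType.Exports.

Local Open Scope ring_scope.
Local Open Scope complex_scope.

(* Invariant Riemannian geometry of F(n) = SU(n)/T, described at the base point
   o by the reductive decomposition su(n) = t (+) p.  Elements of su(n) are
   complex matrices; T_o F(n) is identified with p.  Indices start at 0. *)

(* The index set of the summands p_ij. *)
Notation pairs n := {ij : 'I_n * 'I_n | (ij.1 < ij.2)%N}.

(* The coefficients (x_ij), i < j, of an invariant symmetric 2-tensor. *)
Notation coeffs R n := {ffun pairs n -> R^o}.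

Section Flag.
Context {R : realType} {n : nat}.

Local Notation C := (R[i]).
Local Notation M := 'M[C]_n.

Definition bracket (X Y : M) : M := X *m Y - Y *m X.

Definition in_su (X : M) : Prop := (map_mx conjc X)^T = - X /\ \tr X = 0.

Definition in_p (X : M) : Prop := in_su X /\ forall i, X i i = 0.

Definition proj_p (X : M) : M :=
  \matrix_(i, j) (if i == j then 0 else X i j).

Definition proj_t (X : M) : M :=
  \matrix_(i, j) (if i == j then X i j else 0).

Local Notation pairs := (pairs n).

Definition fst_ix (a : pairs) : 'I_n := (val a).1.
Definition snd_ix (a : pairs) : 'I_n := (val a).2.

Definition proj_pij (a : pairs) (X : M) : M :=
  \matrix_(i, j)
    (if ((i, j) == val a) || ((j, i) == val a) then X i j else 0).

(* A real basis of p: E_ij - E_ji is indexed by ((i, j), false) and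
   'i (E_ij + E_ji) by ((i, j), true).  The coordinates of X in p with respect
   to it are the real and imaginary parts of the entries X_ij, i < j. *)
Definition p_vec (a : pairs * bool) : M :=
  let i := fst_ix a.1 in let j := snd_ix a.1 in
  if a.2 then 'i *: (delta_mx i j + delta_mx j i)
  else delta_mx i j - delta_mx j i.

Definition p_coord (a : pairs * bool) (X : M) : R :=
  let z := X (fst_ix a.1) (snd_ix a.1) in
  if a.2 then complex.Im z else complex.Re z.

(* A real basis of t: 'i (E_kk - E_(k+1)(k+1)) for k + 1 < n (then ordS k has
   value k + 1).  The coordinates of diag('i d_0, ..., 'i d_(n-1)) are the
   partial sums d_0 + ... + d_k. *)
Definition t_vec (k : 'I_n) : M :=
  'i *: (delta_mx k k - delta_mx (ordS k) (ordS k)).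

Definition t_coord (k : 'I_n) (X : M) : R :=
  \sum_(l < n | (l <= k)%N) complex.Im (X l l).

(* Traces of real-linear endomorphisms of p and of su(n). *)
Definition tr_p (f : M -> M) : R :=
  \sum_(a : pairs * bool) p_coord a (f (p_vec a)).

Definition tr_su (f : M -> M) : R :=
  \sum_(k < n | (k.+1 < n)%N) t_coord k (f (t_vec k)) + tr_p f.

Definition killing (X Y : M) : R :=
  tr_su (fun Z => bracket X (bracket Y Z)).

Definition Q (X Y : M) : R := - killing X Y.

(* Bilinear forms on p are represented by functions on matrices, of which only
   the values on p matter. *)
Definition form : Type := M -> M -> R.

Definition gram (h : form) : 'M[R]_#|{: pairs * bool}| :=
  \matrix_(r, s) h (p_vec (enum_val r)) (p_vec (enum_val s)).

Definition trace_form (g h : form) : R := \tr (invmx (gram g) *m gram h).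

(* The vector W in p such that g(W, Z) = phi(Z) for all Z in p. *)
Definition sharp (g : form) (phi : M -> R) : M :=
  \sum_r (\sum_s invmx (gram g) r s * phi (p_vec (enum_val s)))%:C
     *: p_vec (enum_val r).

(* Levi-Civita connection of the invariant metric g, as a bilinear map
   p x p -> p (Nomizu); the defining property is the Koszul formula. *)
Definition levi_civita (g : form) (X Y : M) : M :=
  sharp g (fun Z =>
    (g (proj_p (bracket X Y)) Z + g (proj_p (bracket Z X)) Y
     + g X (proj_p (bracket Z Y))) / 2).

(* Curvature at o (Nomizu):
   R(X, Y) = [L_X, L_Y] - L_([X, Y]_p) - ad([X, Y]_t), L the connection map. *)
Definition curvature (g : form) (X Y Z : M) : M :=
  levi_civita g X (levi_civita g Y Z) - levi_civita g Y (levi_civita g X Z)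
  - levi_civita g (proj_p (bracket X Y)) Z
  - bracket (proj_t (bracket X Y)) Z.

Definition ricci (g : form) : form :=
  fun Y Z => tr_p (fun X => curvature g X Y Z).

Definition scalar_curvature (g : form) : R := trace_form g (ricci g).

Local Notation coeffs := (coeffs R n).

(* The invariant symmetric 2-tensor sum_(i < j) x_ij Q|p_ij. *)
Definition tensor (x : coeffs) : form :=
  fun X Y => \sum_a x a * Q (proj_pij a X) (proj_pij a Y).

Definition is_metric (x : coeffs) : Prop := forall a, 0 < x a.

Definition Sc (x : coeffs) : R := scalar_curvature (tensor x).

Definition einstein (x : coeffs) (rho : R) : Prop :=
  is_metric x /\
  forall X Y, in_p X -> in_p Y ->
    ricci (tensor x) X Y = rho * tensor x X Y.

(* v0 stands for the total volume of F(n) with respect to the metric Q. *)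
Definition volume (v0 : R) (x : coeffs) : R :=
  v0 * Num.sqrt (\det (gram (tensor x)) / \det (gram Q)).

(* The manifold of unit-volume invariant metrics. *)
Definition M1 (v0 : R) (x : coeffs) : Prop :=
  is_metric x /\ volume v0 x = 1.

(* Invariant g-traceless tensors, g = tensor x: the tangent space of M1 at x. *)
Definition TT (x v : coeffs) : Prop := trace_form (tensor x) (tensor v) = 0.

Definition twice_differentiable_at0 (f : R -> R) : Prop :=
  (\forall t \near (0 : R), derivable f t 1) /\ derivable (derive1 f) 0 1.

Definition M1_curve (v0 : R) (x v : coeffs) (c : R -> coeffs) : Prop :=
  [/\ forall t, M1 v0 (c t),
      c 0 = x,
      forall a, twice_differentiable_at0 (fun t => c t a : R)
    & forall a, derive1 (fun t => c t a : R) 0 = v a].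

(* H is the Hessian at x of the restriction of Sc to M1: the symmetric bilinear
   form on the tangent space for which H(v, v) is the second derivative of Sc
   along any curve in M1 through x with velocity v.  Such an H exists only at
   critical points, and its values on TT x are then unique. *)
Definition is_hessian (v0 : R) (x : coeffs) (H : coeffs -> coeffs -> R) :=
  [/\ forall u v, TT x u -> TT x v -> H u v = H v u,
      forall (r : R) u u' v, TT x u -> TT x u' -> TT x v ->
        H (r *: u + u') v = r * H u v + H u' v
    & forall v c, TT x v -> M1_curve v0 x v c ->
        derive1n 2 (fun t => Sc (c t)) 0 = H v v].

Definition G_nondegenerate (v0 : R) (x : coeffs) : Prop :=
  exists2 H, is_hessian v0 x H &
    forall u, TT x u -> (forall v, TT x v -> H u v = 0) -> u = 0.

Definition G_unstable (v0 : R) (x : coeffs) : Prop :=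
  exists2 H, is_hessian v0 x H & exists2 v, TT x v & 0 < H v v.

Definition pos_subspace (x : coeffs) (H : coeffs -> coeffs -> R)
    (U : {vspace coeffs}) : Prop :=
  forall v, v \in U -> TT x v /\ (v != 0 -> 0 < H v v).

Definition has_coindex (v0 : R) (x : coeffs) (k : nat) : Prop :=
  exists2 H, is_hessian v0 x H &
    (exists2 U, pos_subspace x H U & \dim U = k) /\
    (forall U, pos_subspace x H U -> (\dim U <= k)%N).

Definition unit_rescaling (v0 : R) (x y : coeffs) : Prop :=
  (exists2 c : R, 0 < c & y = c *: x) /\ volume v0 y = 1.

(* The pairs (i, j), i < j < n, in lexicographic order. *)
Definition lex_pairs : seq (nat * nat) :=
  [seq (i, j) | i <- iota 0 n, j <- iota i.+1 (n - i.+1)].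

Definition lex_coeffs (s : seq R) : coeffs :=
  [ffun a => nth 0 s (index (fst_ix a : nat, snd_ix a : nat) lex_pairs)].

End Flag.

Arguments lex_coeffs {R} n s.

Definition cubic {R : realType} (x : R) : R :=
  14 * x ^+ 3 - 277 * x ^+ 2 + 1819 * x - 3967.

Definition g3 {R : realType} (K : R) : coeffs R 5 :=
  let Z := 41 / 5 * K ^+ 2 - 227 / 2 * K + 3967 / 10 in
  lex_coeffs 5
    [:: - (3967 / 5) + 237 * K - 87 / 5 * K ^+ 2; K; K; K; K; K; K; Z; Z; Z].

(* Main.v *)
(* On p the Killing form is 2n Re tr(XY), so the basis of p is orthogonal for
   every invariant metric and the Levi-Civita connection has a matrix entry
   formula that is complex bilinear.  Traces over p of complex linear maps only
   see the entries of F(E_ij) at (i, j); this gives the classical formula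
     r_ij = 1/(2 x_ij) + 1/(4n) sum_k (x_ij/(x_ik x_jk) - x_ik/(x_ij x_jk)
                                       - x_jk/(x_ij x_ik))
   for the Ricci curvature on p_ij.  For g_3 it reduces to three polynomial
   relations between the coefficients, all consequences of cubic K = 0.

   In logarithmic coordinates the scalar curvature is a combination of
   exponentials of linear forms, and the volume constraint is linear.  At an
   Einstein metric the terms with second derivatives of a curve therefore add up
   to zero, and the Hessian is a combination of squares of linear forms in
   w = v / x.

   For g_3, split w under the symmetry S_2 x S_3 that permutes {1, 2} and
   {3, 4, 5}.  There is an involution J of the tangent space, with 5- and
   4-dimensional eigenspaces for the eigenvalues 1 and -1, such that
   H(u, J u) > 0 for all nonzero u.  Nondegeneracy, instability and the
   coindex 5 all follow from this inequality. *)
Require Import Defs.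
From HB Require Import structures.
From mathcomp Require Import all_boot all_order all_algebra ring lra.
From mathcomp Require Import boolp classical_sets functions reals topology.
From mathcomp Require Import normedtype derive realfun exp complex.

Set Implicit Arguments.
Unset Strict Implicit.
Unset Printing Implicit Defensive.

Import Order.TTheory GRing.Theory Num.Theory.
Import numFieldNormedType.Exports.

Local Open Scope classical_set_scope.
Local Open Scope ring_scope.

(** * Complex numbers and sums over pairs *)

Section ComplexParts.
Context {R : realType}.
Implicit Types z w : R[i].
Local Notation Re := complex.Re.
Local Notation Im := complex.Im.

Lemma ReD z w : Re (z + w) = Re z + Re w.
Proof. by case: z w => [a b] [c d]. Qed.

Lemma ReN z : Re (- z) = - Re z.
Proof. by case: z. Qed.

Lemma ReB z w : Re (z - w) = Re z - Re w.
Proof. by rewrite ReD ReN. Qed.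

Lemma Re_sum (I : Type) (r : seq I) (P : pred I) (F : I -> R[i]) :
  Re (\sum_(i <- r | P i) F i) = \sum_(i <- r | P i) Re (F i).
Proof. exact: (big_morph (@complex.Re R) ReD erefl). Qed.

Lemma ReZ (c : R) z : Re (c%:C * z)%C = c * Re z.
Proof. by case: z => a b /=; rewrite mul0r subr0. Qed.

Lemma Im_mulI z : Im ('i * z) = Re z.
Proof. by rewrite -complexiE mulrC ImiRe. Qed.

Lemma Re_conjc z : Re (conjc z) = Re z.
Proof. by case: z. Qed.

Lemma conjcM z w : conjc (z * w) = conjc z * conjc w.
Proof. exact: rmorphM. Qed.

Lemma conjcN z : conjc (- z) = - conjc z.
Proof. exact: rmorphN. Qed.

Lemma conjc_sum (I : Type) (r : seq I) (P : pred I) (F : I -> R[i]) :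
  conjc (\sum_(i <- r | P i) F i) = \sum_(i <- r | P i) conjc (F i).
Proof. exact: (rmorph_sum conjc). Qed.

Lemma conjcI : conjc ('i : R[i]) = - 'i.
Proof. by rewrite -complexiE; apply/eqP; rewrite eq_complex /= oppr0 !eqxx. Qed.

End ComplexParts.

(** Symmetric extension to all ordered index pairs, 0 on the diagonal, so that sums over distinct
    indices need no choice of order. *)
Definition sym_coeff (V : zmodType) (n : nat) (x : pairs n -> V) (i j : 'I_n) : V :=
  if insub (i, j) is Some a then x a
  else if insub (j, i) is Some a then x a else 0.

Section Pairs.
Context {n : nat}.
Implicit Types a b : pairs n.

Lemma ltn_pair a : (fst_ix a < snd_ix a)%N.
Proof. exact: (valP a). Qed.

Lemma neq_pair a : fst_ix a != snd_ix a.
Proof. by rewrite neq_ltn ltn_pair. Qed.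

Lemma val_pairE a : val a = (fst_ix a, snd_ix a).
Proof. by rewrite /fst_ix /snd_ix; case: (val a). Qed.

Lemma eq_pair a b : (a == b) = (fst_ix a == fst_ix b) && (snd_ix a == snd_ix b).
Proof. by rewrite -val_eqE /= !val_pairE. Qed.

Lemma pairC_eq a b : (fst_ix a == snd_ix b) && (snd_ix a == fst_ix b) = false.
Proof.
apply/negP => /andP[/eqP e1 /eqP e2]; have := ltn_pair a.
by rewrite e1 e2 ltnNge ltnW // ltn_pair.
Qed.

Lemma sum_pairs (V : nmodType) (F : 'I_n -> 'I_n -> V) :
  \sum_(a : pairs n) F (fst_ix a) (snd_ix a) =
  \sum_(i < n) \sum_(j < n | (i < j)%N) F i j.
Proof.
rewrite pair_big_dep /=.
pose A : {pred 'I_n * 'I_n} := fun ij => (ij.1 < ij.2)%N.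
have eA : \sum_(ij in A | true) F ij.1 ij.2 =
    \sum_(a : pairs n) F (fst_ix a) (snd_ix a).
  exact: (big_sub_cond A xpredT (fun ij => F ij.1 ij.2)).
by rewrite -eA; apply: eq_bigl => ij; rewrite andbT.
Qed.

Lemma sum_offdiag_sym (V : nmodType) (F : 'I_n -> 'I_n -> V) :
  (forall i j, F i j = F j i) ->
  \sum_(i < n) \sum_(j < n | j != i) F i j =
  (\sum_(i < n) \sum_(j < n | (i < j)%N) F i j) *+ 2.
Proof.
move=> FC; rewrite mulr2n.
have -> : \sum_(i < n) \sum_(j < n | j != i) F i j =
    \sum_(i < n) (\sum_(j < n | (i < j)%N) F i j + \sum_(j < n | (j < i)%N) F i j).
  apply: eq_bigr => i _; rewrite (bigID (fun j : 'I_n => (i < j)%N)) /=.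
  by congr (_ + _); apply: eq_bigl => j; rewrite neq_ltn; case: ltngtP.
rewrite big_split /=; congr (_ + _).
rewrite (exchange_big_dep xpredT) //=.
by apply: eq_bigr => i _; apply: eq_bigr => j _; rewrite FC.
Qed.

Lemma sym_coeffC (V : zmodType) (x : pairs n -> V) i j :
  sym_coeff x i j = sym_coeff x j i.
Proof.
rewrite /sym_coeff; case: insubP => [a aij _|]; case: insubP => [b bij _|] //.
by move: aij bij => /= lt_ij; rewrite ltnNge ltnW.
Qed.

Lemma sym_coeff_pair (V : zmodType) (x : pairs n -> V) a :
  sym_coeff x (fst_ix a) (snd_ix a) = x a.
Proof. by rewrite /sym_coeff -val_pairE valK. Qed.

Lemma sym_coeffii (V : zmodType) (x : pairs n -> V) i : sym_coeff x i i = 0.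
Proof. by rewrite /sym_coeff insubF //= ltnn. Qed.

Lemma pairP i j : i != j ->
  exists a, (fst_ix a = i /\ snd_ix a = j) \/ (fst_ix a = j /\ snd_ix a = i).
Proof.
rewrite neq_ltn => /orP[lt_ij|lt_ji].
  by exists (exist _ (i, j) lt_ij); left.
by exists (exist _ (j, i) lt_ji); right.
Qed.

Lemma sym_coeff_gt0 (R : numDomainType) (x : pairs n -> R) i j :
  (forall a, 0 < x a) -> i != j -> 0 < sym_coeff x i j.
Proof.
move=> x_gt0 /pairP[a [[<- <-]|[<- <-]]]; last rewrite sym_coeffC.
  by rewrite sym_coeff_pair.
by rewrite sym_coeff_pair.
Qed.

End Pairs.

(** For fixed l the sum over k telescopes to D l l minus the entry of the last row; the last row
    sums to zero by hypothesis. *)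
Lemma telescope_ord (V : zmodType) (n : nat) (D : 'I_n -> 'I_n -> V) :
  (forall k, \sum_l D k l = 0) ->
  \sum_(l < n) \sum_(k < n | (k.+1 < n)%N && (l <= k)%N) (D k l - D (ordS k) l) =
  \sum_k D k k.
Proof.
case: n D => [|m] D D0; first by rewrite !big_ord0.
transitivity (\sum_(l < m.+1) (D l l - D ord_max l)); last first.
  by rewrite sumrB D0 subr0.
apply: eq_bigr => l _; pose d k := - D (inord k) l.
transitivity (\sum_(l <= k < m) (d k.+1 - d k)).
  rewrite big_geq_mkord (big_ord_widen_cond m.+1 (fun k => l <= k)%N
    (fun k => d k.+1 - d k)) //.
  apply: eq_big => k; first by rewrite ltnS andbC.
  case/andP=> km lk; rewrite /d inord_val opprK [RHS]addrC; congr (_ - D _ _).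
  by apply: val_inj; rewrite /= inordK // modn_small.
rewrite telescope_sumr -1?ltnS // /d inord_val opprK addrC.
by congr (_ - D _ _); apply: val_inj; rewrite /= inordK.
Qed.

(** * Traces and the Killing form *)

Section Flag.
Context {R : realType} {n : nat}.
Local Notation C := (R[i]).
Local Notation M := 'M[C]_n.
Local Notation Re := complex.Re.
Local Notation Im := complex.Im.
Local Notation E := (delta_mx : 'I_n -> 'I_n -> M).
Implicit Types X Y Z W : M.

Lemma in_su_conj X i j : in_su X -> conjc (X i j) = - X j i.
Proof. by case=> /matrixP/(_ j i); rewrite !mxE. Qed.

Lemma in_su_bracket X Y : in_su X -> in_su Y -> in_su (bracket X Y).
Proof.
move=> [hX _] [hY _]; split; last first.
  by rewrite /bracket raddfB /= mxtrace_mulC subrr.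
rewrite /bracket map_mxB !map_mxM raddfB /= !trmx_mul.
by rewrite hX hY !mulNmx !mulmxN !opprK opprB.
Qed.

Lemma in_p_su X : in_p X -> in_su X. Proof. by case. Qed.

Lemma in_p_proj X : in_su X -> in_p (proj_p X).
Proof.
move=> sX; split=> [|i]; last by rewrite mxE eqxx.
split; last by rewrite /mxtrace big1 // => i _; rewrite mxE eqxx.
apply/matrixP=> i j; rewrite !mxE eq_sym; case: eqP => _.
  by rewrite conjc0 oppr0.
by rewrite in_su_conj.
Qed.

Lemma in_p_pij a X : in_su X -> in_p (proj_pij a X).
Proof.
move=> sX.
have d0 i : proj_pij a X i i = 0.
  rewrite mxE orbb; case: ifP => // /eqP e.
  by have := neq_pair a; rewrite /fst_ix /snd_ix -e eqxx.
split=> //; split; last by rewrite /mxtrace big1.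
apply/matrixP=> i j; rewrite !mxE orbC; case: ifP => _; last by rewrite conjc0 oppr0.
by rewrite in_su_conj.
Qed.

Lemma p_vecE (a : pairs n * bool) i j :
  p_vec a i j = (if a.2 then 'i else 1) * ((i == fst_ix a.1) && (j == snd_ix a.1))%:R
     + (if a.2 then 'i else -1) * ((i == snd_ix a.1) && (j == fst_ix a.1))%:R :> C.
Proof.
by rewrite /p_vec; case: a => a [] /=; rewrite !mxE ?mulrDr // mul1r mulN1r.
Qed.

Lemma in_p_pvec (a : pairs n * bool) : in_p (p_vec a : M).
Proof.
have d0 i : p_vec a i i = 0 :> C.
  rewrite p_vecE; have [->|_] := eqVneq i (fst_ix a.1).
    by rewrite (negPf (neq_pair _)) !mulr0 addr0.
  by rewrite andbF !mulr0 addr0.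
split=> //; split; last by rewrite /mxtrace big1.
apply/matrixP=> i j; rewrite !mxE !p_vecE rmorphD !rmorphM /= !conjc_nat.
rewrite opprD addrC -!mulNr [(j == _) && _]andbC [(j == _) && _]andbC.
by case: a.2; rewrite ?conjcI // conjcN conjc1 opprK.
Qed.

Lemma p_coord_p_vec (a b : pairs n * bool) :
  p_coord a (p_vec b : M) = (a == b)%:R.
Proof.
rewrite /p_coord p_vecE; case: a b => [a u] [b v] /=.
rewrite pairC_eq mulr0 addr0 -eq_pair -pair_eqE /= /pair_eq /=.
by case: (a == b); case: v; case: u; rewrite ?mulr0 ?mulr1 //= -complexiE.
Qed.

(** The coordinates give the entries above the diagonal; skew-Hermitian symmetry gives those
    below. *)
Lemma p_decomp X : in_p X -> X = \sum_a (p_coord a X)%:C%C *: p_vec a.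
Proof.
move=> [sX X0]; apply/matrixP => i j; rewrite summxE.
rewrite (eq_bigr (fun a => (p_coord a X)%:C%C * p_vec a i j)); last first.
  by move=> a _; rewrite mxE.
have key (b : pairs n) : X (fst_ix b) (snd_ix b) =
   \sum_a (p_coord a X)%:C%C * p_vec a (fst_ix b) (snd_ix b).
  rewrite (bigD1 (b, true)) //= (bigD1 (b, false)) /=; last by apply/eqP; case.
  rewrite big1 ?addr0.
    rewrite !p_vecE /= !eqxx !pairC_eq !mulr0 !addr0 !mulr1 /p_coord /=.
    by rewrite addrC [_ * 'i]mulrC -complexiE [LHS]complexE.
  move=> [c u]; have [->|/negPf cb] := eqVneq c b.
    by case: u; rewrite eqxx ?andbF.
  by rewrite p_vecE /= pairC_eq -eq_pair [b == c]eq_sym cb !mulr0 addr0 mulr0.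
have [<-|/pairP[b [[<- <-]|[<- <-]]]] := eqVneq i j; last 2 first.
- exact: key.
- rewrite -[LHS]opprK -in_su_conj // key conjc_sum -sumrN.
  apply: eq_bigr => a _; rewrite conjcM conjc_real -mulrN.
  by rewrite (in_su_conj _ _ (in_p_su (in_p_pvec a))) opprK.
by rewrite X0 big1 // => a _; case: (in_p_pvec a) => _ ->; rewrite mulr0.
Qed.

Lemma mul_delta_mulE X Y a b i j : (X *m E a b *m Y) i j = X i a * Y b j.
Proof.
rewrite mxE (bigD1 b) //= big1 ?addr0 => [|k /negPf kb].
  rewrite mxE (bigD1 a) //= big1 ?addr0 => [|k /negPf ka].
    by rewrite mxE !eqxx mulr1.
  by rewrite mxE ka mulr0.
rewrite [X in X * _]mxE big1 ?mul0r // => l _.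
by rewrite mxE kb andbF mulr0.
Qed.

Lemma mul_deltaE X a b i j : (X *m E a b) i j = X i a *+ (j == b).
Proof.
by rewrite -[X *m _]mulmx1 mul_delta_mulE mxE mulr_natr eq_sym.
Qed.

Lemma delta_mulE Y a b i j : (E a b *m Y) i j = Y b j *+ (i == a).
Proof. by rewrite -[E a b]mul1mx mul_delta_mulE mxE mulr_natl. Qed.

(* E_ij - E_ji contributes Re F(E_ij)_ij - Re F(E_ji)_ij and i (E_ij + E_ji)
   contributes Re F(E_ij)_ij + Re F(E_ji)_ij, by complex linearity. *)
Lemma tr_p_linear (f F : M -> M) :
  linear F -> (forall a, f (p_vec a) = F (p_vec a)) ->
  tr_p f = \sum_a 2 * Re (F (E (fst_ix a) (snd_ix a)) (fst_ix a) (snd_ix a)).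
Proof.
move=> linF fF.
pose G : {linear M -> M} := HB.pack F (GRing.isLinear.Build C M M *:%R F linF).
rewrite /tr_p -(pair_bigA _ (fun a b => p_coord (a, b) (f (p_vec (a, b))))) /=.
apply: eq_bigr => a _; rewrite big_bool /= !fF /p_coord /= /p_vec /=.
rewrite -[F]/(G : M -> M) linearZ linearD linearB.
move: (G (E _ _)) (G (E (snd_ix a) _)) => A B.
by rewrite !mxE Im_mulI ReD ReB; ring.
Qed.

(** The coordinate dual to i (E_kk - E_(k+1)(k+1)) is a partial sum of the diagonal, so the trace is
    a telescoping double sum. Tracelessness of F(E_kk) removes its boundary terms. *)
Lemma tr_t_linear (f F : M -> M) :
  linear F -> (forall k, f (t_vec k) = F (t_vec k)) ->
  (forall k, \tr (F (E k k)) = 0) ->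
  \sum_(k < n | (k.+1 < n)%N) t_coord k (f (t_vec k)) =
  \sum_k Re (F (E k k) k k).
Proof.
move=> linF fF trF.
pose G : {linear M -> M} := HB.pack F (GRing.isLinear.Build C M M *:%R F linF).
pose D k l : R := Re (F (E k k) l l).
have -> : \sum_(k < n | (k.+1 < n)%N) t_coord k (f (t_vec k)) =
    \sum_(k < n | (k.+1 < n)%N) \sum_(l < n | (l <= k)%N) (D k l - D (ordS k) l).
  apply: eq_bigr => k _; rewrite /t_coord fF /t_vec -[F]/(G : M -> M).
  rewrite linearZ linearB /=; apply: eq_bigr => l _; rewrite /D.
  by move: (F _) (F (E (ordS k) _)) => A B; rewrite !mxE Im_mulI ReB.
rewrite (exchange_big_dep xpredT) //=.
have D0 k : \sum_l D k l = 0 by rewrite -Re_sum [\sum_l _]trF.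
exact: telescope_ord.
Qed.

Lemma linear_bracketr X : linear (bracket X).
Proof.
move=> c Z W; rewrite /bracket mulmxDr mulmxDl -scalemxAr -scalemxAl.
by rewrite scalerBr opprD addrACA.
Qed.

Lemma linear_bracket2 X Y : linear (fun Z => bracket X (bracket Y Z)).
Proof. by move=> c Z W; rewrite !linear_bracketr. Qed.

Lemma mxtrace_bracket X Y : \tr (bracket X Y) = 0.
Proof. by rewrite /bracket raddfB /= mxtrace_mulC subrr. Qed.

Lemma bracket2_deltaE X Y a b : bracket X (bracket Y (E a b)) a b =
  (X *m Y) a a + (Y *m X) b b - X a a * Y b b - Y a a * X b b.
Proof.
rewrite /bracket mulmxBr mulmxBl !mulmxA.
have e (U V W K : M) : (U - V - (W - K)) a b = U a b - V a b - (W a b - K a b).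
  by rewrite !mxE.
rewrite e !mul_delta_mulE -(mulmxA (E a b)) delta_mulE mul_deltaE !eqxx.
by rewrite !mulr1n; ring.
Qed.

Lemma Re_mulC_diag X Y i : in_su X -> in_su Y ->
  Re ((X *m Y) i i) = Re ((Y *m X) i i).
Proof.
move=> sX sY; rewrite !mxE !Re_sum; apply: eq_bigr => k _.
by rewrite -Re_conjc conjcM !in_su_conj // mulrNN mulrC.
Qed.

(** With s_i the real part of (XY)_ii, the torus contributes 2 sum s_i, and p contributes s_i + s_j
    for each ordered pair i != j, which is (2n - 2) sum s_i in all. *)
Lemma killing_p X Y : in_p X -> in_p Y ->
  killing X Y = 2 * n%:R * Re (\tr (X *m Y)).
Proof.
move=> [sX X0] [sY Y0]; pose F Z := bracket X (bracket Y Z).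
have linF : linear F by exact: linear_bracket2.
have FE a b : F (E a b) a b = (X *m Y) a a + (Y *m X) b b.
  by rewrite /F bracket2_deltaE !X0 !Y0 !mul0r !subr0.
rewrite /killing /tr_su (tr_t_linear (f := F) linF) // => [|k]; last exact: mxtrace_bracket.
rewrite (tr_p_linear linF) //.
pose s i := Re ((X *m Y) i i).
have -> : \sum_k Re (F (E k k) k k) = 2 * \sum_k s k.
  rewrite mulr_sumr; apply: eq_bigr => k _.
  by rewrite FE ReD -(Re_mulC_diag _ sX sY) /s; ring.
have -> : \sum_(a : pairs n) 2 * Re (F (E (fst_ix a) (snd_ix a)) (fst_ix a) (snd_ix a))
    = \sum_(i < n) \sum_(j < n | j != i) (s i + s j).
  rewrite sum_offdiag_sym => [|i j]; last exact: addrC.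
  rewrite -[RHS]mulr_natl -sum_pairs mulr_sumr; apply: eq_bigr => a _.
  by rewrite FE ReD -(Re_mulC_diag _ sX sY).
have -> : Re (\tr (X *m Y)) = \sum_k s k by rewrite Re_sum.
have -> : \sum_(i < n) \sum_(j < n | j != i) (s i + s j) =
    \sum_(i < n) (n%:R * s i + \sum_j s j - 2 * s i).
  apply: eq_bigr => i _; have -> : n%:R * s i = \sum_(j < n) s i.
    by rewrite sumr_const card_ord mulr_natl.
  by rewrite -big_split /= [in RHS](bigD1 i) //=; ring.
rewrite sumrB big_split /= sumr_const card_ord -!mulr_sumr -[_ *+ n]mulr_natl.
ring.
Qed.

End Flag.

(** * Invariant tensors *)

Section Tensor.
Context {R : realType} {n : nat}.
Local Notation C := (R[i]).
Local Notation M := 'M[C]_n.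
Local Notation Re := complex.Re.
Local Notation Im := complex.Im.
Local Notation E := (delta_mx : 'I_n -> 'I_n -> M).
Implicit Types (X Y Z W : M) (x y : coeffs R n).

Definition coef x : 'I_n -> 'I_n -> R := sym_coeff (fun a => x a : R).

Lemma coef_sym x i j : coef x i j = coef x j i.
Proof. exact: sym_coeffC. Qed.

Lemma coef_pair x a : coef x (fst_ix a) (snd_ix a) = x a.
Proof. exact: sym_coeff_pair. Qed.

Lemma coefii x i : coef x i i = 0.
Proof. exact: sym_coeffii. Qed.

Lemma coef_gt0 x i j : is_metric x -> i != j -> 0 < coef x i j.
Proof. exact: sym_coeff_gt0. Qed.

Lemma mxtrace_delta_mul W i j : \tr (E i j *m W) = W j i.
Proof.
rewrite /mxtrace (bigD1 i) //= big1 => [|k /negPf ki]; rewrite delta_mulE.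
  by rewrite eqxx addr0.
by rewrite ki.
Qed.

Lemma proj_pijE a X :
  proj_pij a X = X (fst_ix a) (snd_ix a) *: E (fst_ix a) (snd_ix a)
               + X (snd_ix a) (fst_ix a) *: E (snd_ix a) (fst_ix a).
Proof.
have /negPf ne := neq_pair a.
apply/matrixP => i j; rewrite !mxE !val_pairE !xpair_eqE.
rewrite [(j == fst_ix a) && _]andbC.
have [/andP[/eqP-> /eqP->]|_] := boolP ((i == fst_ix a) && (j == snd_ix a)).
  by rewrite ne mulr1 mulr0 addr0.
have [/andP[/eqP-> /eqP->]|_] /= := boolP ((i == snd_ix a) && (j == fst_ix a)).
  by rewrite mulr1 mulr0 add0r.
by rewrite !mulr0 addr0.
Qed.

Lemma Q_p X Y : in_p X -> in_p Y -> Q X Y = - (2 * n%:R * Re (\tr (X *m Y))).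
Proof. by move=> pX pY; rewrite /Q killing_p. Qed.

Lemma Re_mulC_su X Y i j : in_su X -> in_su Y ->
  Re (X i j * Y j i) = Re (X j i * Y i j).
Proof. by move=> sX sY; rewrite -Re_conjc conjcM !in_su_conj // mulrNN. Qed.

Lemma tensor_su x X Y : in_su X -> in_su Y ->
  tensor x X Y = - (4 * n%:R *
    \sum_a x a * Re (X (fst_ix a) (snd_ix a) * Y (snd_ix a) (fst_ix a))).
Proof.
move=> sX sY; rewrite /tensor mulr_sumr -sumrN; apply: eq_bigr => a _.
rewrite Q_p; try exact: in_p_pij.
rewrite {1}proj_pijE mulmxDl -!scalemxAl mxtraceD !mxtraceZ !mxtrace_delta_mul.
rewrite !mxE !val_pairE !eqxx orbT /= ReD [X in _ + X]Re_mulC_su //; ring.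
Qed.

(* With D = hadamard (coef x), the metric on p is -2n Re tr(D(X) Y). *)
Definition hadamard (s : 'I_n -> 'I_n -> R) X : M :=
  \matrix_(i, j) ((s i j)%:C%C * X i j).

Lemma mxtrace_mulE X Y : \tr (X *m Y) = \sum_i \sum_j X i j * Y j i.
Proof. by apply: eq_bigr => i _; rewrite mxE. Qed.

Lemma tensor_trace x X Y : in_su X -> in_su Y ->
  tensor x X Y = - (2 * n%:R * Re (\tr (hadamard (coef x) X *m Y))).
Proof.
move=> sX sY; rewrite tensor_su // mxtrace_mulE Re_sum.
pose F i j := coef x i j * Re (X i j * Y j i).
have -> : \sum_a x a * Re (X (fst_ix a) (snd_ix a) * Y (snd_ix a) (fst_ix a)) =
   \sum_a F (fst_ix a) (snd_ix a).
  by apply: eq_bigr => a _; rewrite /F coef_pair.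
rewrite sum_pairs.
have := @sum_offdiag_sym n R F (fun i j => _); rewrite mulr2n => FE.
have -> : \sum_i Re (\sum_j hadamard (coef x) X i j * Y j i) =
   \sum_(i < n) \sum_(j < n | j != i) F i j.
  apply: eq_bigr => i _; rewrite Re_sum (bigD1 i) //= mxE coefii.
  rewrite -mulrA ReZ mul0r add0r.
  by apply: eq_bigr => j _; rewrite mxE -mulrA ReZ.
rewrite FE => [|i j]; last by rewrite /F coef_sym Re_mulC_su.
ring.
Qed.

(** Skew-Hermitian symmetry turns - Re(X_ij Y_ji) into the Euclidean product of the coordinates, so
    every invariant tensor is diagonal in the basis [p_vec]. *)
Lemma tensor_p_coord x X Y : in_su X -> in_su Y ->
  tensor x X Y =
  4 * n%:R * \sum_(u : pairs n * bool) x u.1 * (p_coord u X * p_coord u Y).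
Proof.
move=> sX sY; rewrite tensor_su // -mulrN; congr (_ * _).
rewrite -sumrN -(pair_bigA _ (fun a b => x a * (p_coord (a, b) X * p_coord (a, b) Y))).
apply: eq_bigr => a _ /=; rewrite big_bool /p_coord /= -mulrDr -mulrN; congr (_ * _).
rewrite -[Y (snd_ix a) _]opprK -in_su_conj //.
by case: (X _ _) (Y _ _) => [r1 i1] [r2 i2] /=; ring.
Qed.

Lemma tensor_p_vec x X u : in_su X ->
  tensor x X (p_vec u) = 4 * n%:R * x u.1 * p_coord u X.
Proof.
move=> sX; rewrite tensor_p_coord //; last exact: in_p_su (in_p_pvec u).
rewrite (bigD1 u) //= big1 => [|v /negPf vu]; rewrite p_coord_p_vec.
  by rewrite eqxx addr0 mulr1 mulrA.
by rewrite vu !mulr0.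
Qed.

Lemma n_neq0 (a : pairs n) : n%:R != 0 :> R.
Proof. by rewrite pnatr_eq0 -lt0n (leq_ltn_trans (leq0n (fst_ix a))). Qed.

Lemma gram_tensor x :
  gram (tensor x) = diag_mx (\row_r (4 * n%:R * x (enum_val r).1)).
Proof.
apply/matrixP=> r s; rewrite !mxE tensor_p_vec; last exact: in_p_su (in_p_pvec _).
rewrite p_coord_p_vec (inj_eq enum_val_inj) eq_sym.
by have [->|_] := eqVneq r s; rewrite (mulr1, mulr0).
Qed.

Lemma invmx_gram x : (forall a, x a != 0) ->
  invmx (gram (tensor x)) = diag_mx (\row_r (4 * n%:R * x (enum_val r).1)^-1).
Proof.
move=> x0; rewrite gram_tensor; set A := diag_mx _; set B := diag_mx _.
have AB : A *m B = 1%:M.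
  rewrite mulmx_diag; apply/matrixP=> r s; rewrite !mxE; case: eqP => // _.
  rewrite !mulr1n mulfV // !mulf_neq0 ?pnatr_eq0 // -lt0n.
  by rewrite (leq_ltn_trans _ (ltn_ord (fst_ix (enum_val r).1))).
have uA : A \in unitmx by case: (mulmx1_unit AB).
by rewrite -[invmx A]mulmx1 -AB mulKmx.
Qed.

Lemma sum_enum_val (V : nmodType) (F : pairs n * bool -> V) :
  \sum_(r < #|{: pairs n * bool}|) F (enum_val r) = \sum_u F u.
Proof. by rewrite -big_enum_val. Qed.

Lemma prod_enum_val (F : pairs n * bool -> R) :
  \prod_(r < #|{: pairs n * bool}|) F (enum_val r) = \prod_u F u.
Proof. by rewrite -big_enum_val. Qed.

(** The Gram matrix of the metric is diagonal, so only the diagonal values of [h] enter; the factor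
    2 is the real dimension of p_ij. *)
Lemma trace_form_tensor x y h : (forall a, x a != 0) ->
  (forall u, h (p_vec u) (p_vec u) = tensor y (p_vec u) (p_vec u)) ->
  trace_form (tensor x) h = 2 * \sum_a (y a : R) / x a.
Proof.
move=> x0 hy; rewrite /trace_form invmx_gram // mul_diag_mx /mxtrace.
rewrite (eq_bigr (fun r => (y (enum_val r).1 : R) / x (enum_val r).1)) => [|r _].
  rewrite (sum_enum_val (fun u => (y u.1 : R) / x u.1)).
  rewrite -(pair_bigA _ (fun a b => (y a : R) / x a)) /= mulr_sumr.
  by apply: eq_bigr => a _; rewrite big_bool /=; ring.
rewrite !mxE hy tensor_p_vec; last exact: in_p_su (in_p_pvec _).
rewrite p_coord_p_vec eqxx; have := n_neq0 (enum_val r).1; move: (x0 (enum_val r).1).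
by rewrite mulr1 => hx hn; field; rewrite hx.
Qed.

(** Makes the volume a quotient of two diagonal determinants. *)
Lemma gramQ : gram (@Q R n) = gram (tensor [ffun=> 1]).
Proof.
apply/matrixP => r s; rewrite !mxE Q_p; try exact: in_p_pvec.
rewrite tensor_trace; try exact: in_p_su (in_p_pvec _).
congr (- (_ * Re (\tr (_ *m _)))).
apply/matrixP => i j; rewrite [RHS]mxE.
have [<-|/pairP[a ij]] := eqVneq i j.
  by case: (in_p_pvec (R := R) (enum_val r)) => _ ->; rewrite mulr0.
suff -> : coef [ffun=> 1] i j = 1 :> R by rewrite mul1r.
by case: ij => [[<- <-]|[<- <-]]; last rewrite coef_sym;
  rewrite coef_pair ffunE.
Qed.

(** Each p_ij has real dimension 2, so the quotient of determinants is the square of the product of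
    the coefficients. *)
Lemma volumeE (v0 : R) x : is_metric x -> volume v0 x = v0 * \prod_a x a.
Proof.
move=> x_gt0; rewrite /volume gramQ !gram_tensor !det_diag -prodf_div.
rewrite (eq_bigr (fun r => x (enum_val r).1 : R)) => [|r _]; last first.
  rewrite !mxE ffunE; have hn := n_neq0 (enum_val r).1.
  by field.
rewrite (prod_enum_val (fun u => x u.1)).
rewrite -(pair_bigA _ (fun (a : pairs n) (b : bool) => x a : R)) /=.
under eq_bigr do rewrite big_bool /=.
rewrite big_split /= -expr2 sqrtr_sqr ger0_norm //.
by apply: prodr_ge0 => a _; apply: ltW.
Qed.

Lemma TT_sum x v : is_metric x -> TT x v <-> \sum_a (v a : R) / x a = 0.
Proof.
move=> x_gt0; rewrite /TT (trace_form_tensor (y := v)) // => [|a]; last exact: lt0r_neq0.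
split=> [/eqP|->]; last by rewrite mulr0.
by rewrite mulf_eq0 pnatr_eq0 /= => /eqP.
Qed.

End Tensor.

(** * Levi-Civita connection *)

Section LeviCivita.
Context {R : realType} {n : nat}.
Local Notation C := (R[i]).
Local Notation M := 'M[C]_n.
Local Notation Re := complex.Re.
Local Notation Im := complex.Im.
Local Notation E := (delta_mx : 'I_n -> 'I_n -> M).
Implicit Types (X Y Z W : M) (x y : coeffs R n) (s : 'I_n -> 'I_n -> R).

Lemma Re_double (z : C) : Re (2%:R * z) = 2 * Re z.
Proof. by rewrite mulr_natl mulr2n ReD mulr_natl mulr2n. Qed.

(* The values at i = j are junk; [conn] sets the diagonal to 0. *)
Definition conn_coef s i k j : R := (s i j + s k j - s i k) / (2 * s i j).

(** Entrywise solution of 2 D(W) = D[X, Y] + [X, DY] + [Y, DX] off the diagonal, with D =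
    [hadamard s]. Being complex bilinear, it can be evaluated at matrix units, which lie outside
    p. *)
Definition conn s X Y : M :=
  \matrix_(i, j) (if i == j then 0 else
    \sum_k ((conn_coef s i k j)%:C%C * X i k * Y k j
            - (conn_coef s j k i)%:C%C * Y i k * X k j)).

Lemma conn_diag s X Y i : conn s X Y i i = 0.
Proof. by rewrite mxE eqxx. Qed.

Lemma in_p_conn s X Y : (forall i j, s i j = s j i) ->
  in_su X -> in_su Y -> in_p (conn s X Y).
Proof.
move=> sC sX sY; split=> [|i]; last exact: conn_diag.
split; last by rewrite /mxtrace big1 // => i _; rewrite conn_diag.
apply/matrixP=> i j; rewrite !mxE eq_sym; case: eqP => _.
  by rewrite conjc0 oppr0.
rewrite conjc_sum -sumrN; apply: eq_bigr => k _.
rewrite rmorphB /= !conjcM !conjc_real !in_su_conj // !mulrN !mulNr !opprK.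
by ring.
Qed.

Lemma linear_conn_l s Z : linear (fun X => conn s X Z).
Proof.
move=> c X Y; apply/matrixP=> i j; rewrite !mxE; case: eqP => _.
  by rewrite mulr0 addr0.
by rewrite mulr_sumr -big_split /=; apply: eq_bigr => k _; rewrite !mxE; ring.
Qed.

Lemma linear_conn_r s Z : linear (conn s Z).
Proof.
move=> c X Y; apply/matrixP=> i j; rewrite !mxE; case: eqP => _.
  by rewrite mulr0 addr0.
by rewrite mulr_sumr -big_split /=; apply: eq_bigr => k _; rewrite !mxE; ring.
Qed.

Lemma eq_mxtrace_offdiag X Y Z : (forall i, Z i i = 0) ->
  (forall i j, i != j -> X i j = Y i j) -> \tr (X *m Z) = \tr (Y *m Z).
Proof.
move=> Z0 XY; rewrite !mxtrace_mulE; apply: eq_bigr => i _; apply: eq_bigr => j _.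
by have [->|/XY->//] := eqVneq i j; rewrite Z0 !mulr0.
Qed.

Lemma tensor_proj_l x X Y : in_su X -> in_su Y ->
  tensor x (proj_p X) Y = tensor x X Y.
Proof.
move=> sX sY; rewrite !tensor_trace //; last exact: in_p_su (in_p_proj sX).
congr (- (_ * Re (\tr (_ *m _)))); apply/matrixP => i j; rewrite !mxE.
by case: eqP => // ->; rewrite coefii mulr0 mul0r.
Qed.

Lemma tensorC x X Y : in_su X -> in_su Y -> tensor x X Y = tensor x Y X.
Proof.
move=> sX sY; rewrite !tensor_p_coord //; congr (_ * _).
by apply: eq_bigr => u _; rewrite [p_coord u X * _]mulrC.
Qed.

Lemma mxtrace_hadamardC s X Y : (forall i j, s i j = s j i) ->
  \tr (hadamard s X *m Y) = \tr (X *m hadamard s Y).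
Proof.
move=> sC; rewrite !mxtrace_mulE; apply: eq_bigr => i _; apply: eq_bigr => j _.
by rewrite !mxE sC mulrCA mulrA.
Qed.

Lemma mxtrace_bracketl X Y Z : \tr (bracket Z X *m Y) = \tr (bracket X Y *m Z).
Proof.
have tr3 (U V K : M) : \tr (U *m V *m K) = \tr (V *m K *m U).
  by rewrite -mulmxA mxtrace_mulC.
by rewrite /bracket !mulmxBl !raddfB /= tr3 [\tr (X *m Z *m Y)]tr3 [\tr (Z *m _ *m _)]tr3.
Qed.

(** Self-adjointness of D and cyclicity of the trace isolate Z, as the Koszul formula requires. *)
Lemma tensor_bracketl x X Y Z : in_su X -> in_su Y -> in_su Z ->
  tensor x (proj_p (bracket Z X)) Y =
  - (2 * n%:R * Re (\tr (bracket X (hadamard (coef x) Y) *m Z))).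
Proof.
move=> sX sY sZ; have sB := in_su_bracket sZ sX.
rewrite (tensor_proj_l x sB sY) (tensor_trace x sB sY) (mxtrace_hadamardC _ _ (coef_sym x)).
by rewrite mxtrace_bracketl.
Qed.

(** All three terms become traces against Z. Since Z has zero diagonal, only the off-diagonal
    entries of D[X, Y] + [X, DY] + [Y, DX] and 2 D([conn]) have to agree. *)
Lemma koszul x X Y Z : is_metric x -> in_p X -> in_p Y -> in_p Z ->
  tensor x (proj_p (bracket X Y)) Z + tensor x (proj_p (bracket Z X)) Y
    + tensor x X (proj_p (bracket Z Y)) = 2 * tensor x (conn (coef x) X Y) Z.
Proof.
move=> x_gt0 [sX X0] [sY Y0] [sZ Z0].
have [pc _] := in_p_conn (coef_sym x) sX sY.
have sB := in_su_bracket sZ sY.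
rewrite (tensorC x sX (in_p_su (in_p_proj sB))).
rewrite (tensor_bracketl x sX sY sZ) (tensor_bracketl x sY sX sZ).
have sB' := in_su_bracket sX sY.
rewrite (tensor_proj_l x sB' sZ) (tensor_trace x sB' sZ) (tensor_trace x pc sZ).
set A := hadamard _ (bracket _ _); set B := bracket _ _; set D := bracket _ _.
have -> : 2 * - (2 * n%:R * Re (\tr (hadamard (coef x) (conn (coef x) X Y) *m Z)))
   = - (2 * n%:R * Re (\tr ((2%:R : C) *: hadamard (coef x) (conn (coef x) X Y) *m Z))).
  by rewrite -scalemxAl mxtraceZ Re_double; ring.
have sumE (r : R) (p q t : C) :
    - (r * Re p) + - (r * Re q) + - (r * Re t) = - (r * Re (p + q + t)).
  by rewrite !ReD; ring.
rewrite sumE -2!mxtraceD -2!mulmxDl.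
congr (- (_ * Re _)); apply: eq_mxtrace_offdiag => // i j ij.
have sij := lt0r_neq0 (coef_gt0 x_gt0 ij).
rewrite [RHS]mxE [X in _ * X]mxE [X in _ * (_ * X)]mxE (negPf ij) !mulr_sumr.
rewrite /A /B /D !mxE -!sumrB mulr_sumr -!big_split /=.
apply: eq_bigr => k _; rewrite !mxE /conn_coef (coef_sym x j k) (coef_sym x k i) (coef_sym x j i).
move: (X i k) (X k j) (Y i k) (Y k j) => a b c d.
rewrite !(rmorphM, rmorphB, rmorphD, fmorphV, rmorph_nat) /=.
have sij' : (coef x i j)%:C%C != 0 :> C by rewrite fmorph_eq0.
move: (coef x i j)%:C%C (coef x i k)%:C%C (coef x k j)%:C%C sij' => p q r p0.
by field.
Qed.

End LeviCivita.

(** * Ricci curvature *)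

Section Ricci.
Context {R : realType} {n : nat}.
Local Notation C := (R[i]).
Local Notation M := 'M[C]_n.
Local Notation Re := complex.Re.
Local Notation Im := complex.Im.
Local Notation E := (delta_mx : 'I_n -> 'I_n -> M).
Implicit Types (X Y Z W : M) (x y : coeffs R n) (s : 'I_n -> 'I_n -> R).

Lemma sharp_tensor x (phi : M -> R) : (forall a, x a != 0) ->
  sharp (tensor x) phi =
  \sum_(u : pairs n * bool) (phi (p_vec u) / (4 * n%:R * x u.1))%:C%C *: p_vec u.
Proof.
move=> x0; rewrite /sharp invmx_gram //.
pose F (u : pairs n * bool) : M :=
  (phi (p_vec u) / (4 * n%:R * x u.1))%:C%C *: p_vec u.
rewrite -[RHS](sum_enum_val F); apply: eq_bigr => r _.
congr (_%:C%C *: _); rewrite (bigD1 r) //= big1 => [|s /negPf sr].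
  by rewrite !mxE eqxx addr0 mulrC.
by rewrite !mxE eq_sym sr mul0r.
Qed.

Lemma sharpP x W : is_metric x -> in_p W ->
  sharp (tensor x) (fun Z => tensor x W Z) = W.
Proof.
move=> x_gt0 pW; rewrite sharp_tensor => [|a]; last exact: lt0r_neq0.
rewrite [RHS](p_decomp pW); apply: eq_bigr => u _; congr (_%:C%C *: _).
rewrite (tensor_p_vec _ _ (in_p_su pW)) [LHS]mulrC mulKf //.
by rewrite !mulf_neq0 ?pnatr_eq0 ?lt0r_neq0 // -(pnatr_eq0 R) (n_neq0 u.1).
Qed.

Lemma eq_sharp x (phi psi : M -> R) : (forall u, phi (p_vec u) = psi (p_vec u)) ->
  sharp (tensor x) phi = sharp (tensor x) psi.
Proof.
move=> e; apply: eq_bigr => r _; congr (_%:C%C *: _).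
by apply: eq_bigr => q _; rewrite e.
Qed.

Lemma levi_civitaE x X Y : is_metric x -> in_p X -> in_p Y ->
  levi_civita (tensor x) X Y = conn (coef x) X Y.
Proof.
move=> x_gt0 pX pY; have pC := in_p_conn (coef_sym x) (in_p_su pX) (in_p_su pY).
rewrite -[RHS](sharpP x_gt0 pC); apply: eq_sharp => u.
rewrite (koszul x_gt0 pX pY (in_p_pvec u)) mulrC mulKf //.
by rewrite pnatr_eq0.
Qed.

(** Extends the curvature complex linearly in X to all matrices, so that [tr_p_linear] applies. *)
Definition conn_curvature s X Y Z : M :=
  conn s X (conn s Y Z) - conn s Y (conn s X Z)
  - conn s (proj_p (bracket X Y)) Z - bracket (proj_t (bracket X Y)) Z.

Lemma curvatureE x X Y Z : is_metric x -> in_p X -> in_p Y -> in_p Z ->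
  curvature (tensor x) X Y Z = conn_curvature (coef x) X Y Z.
Proof.
move=> x_gt0 pX pY pZ.
have pC V W : in_p V -> in_p W -> in_p (conn (coef x) V W).
  by move=> [sV _] [sW _]; apply: in_p_conn => //; exact: coef_sym.
have pB := in_p_proj (in_su_bracket (in_p_su pX) (in_p_su pY)).
rewrite /curvature (levi_civitaE x_gt0 pY pZ) (levi_civitaE x_gt0 pX pZ).
rewrite (levi_civitaE x_gt0 pX (pC _ _ pY pZ)) (levi_civitaE x_gt0 pY (pC _ _ pX pZ)).
by rewrite (levi_civitaE x_gt0 pB pZ).
Qed.

Lemma linear_bracketl Y : linear (fun X => bracket X Y).
Proof.
move=> c Z W; rewrite /bracket mulmxDr mulmxDl -scalemxAr -scalemxAl.
by rewrite scalerBr opprD addrACA.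
Qed.

Lemma linear_proj_p : linear (@proj_p R n).
Proof.
move=> c X Y; apply/matrixP=> i j; rewrite !mxE; case: eqP => // _.
by rewrite mulr0 addr0.
Qed.

Lemma linear_proj_t : linear (@proj_t R n).
Proof.
move=> c X Y; apply/matrixP=> i j; rewrite !mxE; case: eqP => // _.
by rewrite mulr0 addr0.
Qed.

Lemma linear_conn_curvature s Y Z : linear (fun X => conn_curvature s X Y Z).
Proof.
move=> c X W; rewrite /conn_curvature.
rewrite linear_conn_l linear_bracketl linear_proj_p linear_proj_t.
rewrite !linear_conn_l linear_conn_r linear_bracketl !scalerBr.
have e (a b p q r t u v : M) :
    a + b - (p + q) - (r + t) - (u + v) = a - p - r - u + (b - q - t - v).
  by rewrite !opprD [a + b + _]addrACA [_ + (- r - t)]addrACA [LHS]addrACA.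
exact: e.
Qed.

Lemma conn_delta s a b W i j : i != j ->
  conn s (E a b) W i j =
  ((conn_coef s i b j)%:C%C * W b j) *+ (i == a)
  - ((conn_coef s j a i)%:C%C * W i a) *+ (j == b).
Proof.
move=> /negPf ij; rewrite mxE ij sumrB; congr (_ - _).
  rewrite (bigD1 b) //= big1 => [|k /negPf kb]; rewrite mxE.
    by rewrite eqxx andbT addr0 mulrAC mulr_natr.
  by rewrite kb andbF mulr0 mul0r.
rewrite (bigD1 a) //= big1 => [|k /negPf ka]; rewrite mxE.
  by rewrite eqxx addr0 mulr_natr.
by rewrite ka mulr0.
Qed.

(** The first connection term vanishes because [conn] has zero diagonal. The isotropy term gives -2
    Y_ba Z_ab, and the two remaining terms give the sum over third indices k. *)
Lemma conn_curvature_deltaE s Y Z a b : a != b ->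
    (forall i, Y i i = 0) -> (forall i, Z i i = 0) ->
  conn_curvature s (E a b) Y Z a b = - 2%:R * (Y b a * Z a b) +
    \sum_(k < n | (k != a) && (k != b))
      ((conn_coef s a k b * conn_coef s b a k)%:C%C * (Y a k * Z k a)
       + (conn_coef s b k a * conn_coef s a b k)%:C%C * (Y k b * Z b k)
       - (conn_coef s a k b)%:C%C * (Y b k * Z k b)
       - (conn_coef s b k a)%:C%C * (Y k a * Z a k)).
Proof.
move=> ab Y0 Z0.
have ba : b != a by rewrite eq_sym.
have bracketE i j : bracket (E a b) Y i j = Y b j *+ (i == a) - Y i a *+ (j == b).
  rewrite /bracket -[LHS]/((E a b *m Y - Y *m E a b) i j).
  by move: (delta_mulE Y a b i j) (mul_deltaE Y a b i j) => <- <-; rewrite !mxE.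
pose c i j k := (conn_coef s i j k)%:C%C.
have conn_sum (V W : M) : V a a = 0 -> V b b = 0 -> W a a = 0 -> W b b = 0 ->
    conn s V W a b = \sum_(k < n | (k != a) && (k != b))
      (c a k b * V a k * W k b - c b k a * W a k * V k b).
  move=> Va Vb Wa Wb; rewrite mxE (negPf ab) [RHS]big_mkcond /=.
  apply: eq_bigr => k _.
  have [->|ka] /= := eqVneq k a; first by rewrite Va Wa !mulr0 !mul0r subr0.
  by have [->|kb] := eqVneq k b; rewrite ?Vb ?Wb ?mulr0 ?mul0r ?subr0.
have subE (A B D F : M) i j : (A - B - D - F) i j = A i j - B i j - D i j - F i j.
  by rewrite !mxE.
rewrite /conn_curvature subE.
have -> : conn s (E a b) (conn s Y Z) a b = 0.
  by rewrite conn_delta // !conn_diag !mulr0 !mul0rn subr0.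
have -> : bracket (proj_t (bracket (E a b) Y)) Z a b = 2%:R * (Y b a * Z a b).
  rewrite /bracket -[LHS]/((_ *m Z - Z *m _) a b).
  set T := proj_t _.
  have -> : (T *m Z - Z *m T) a b = (T *m Z) a b - (Z *m T) a b by rewrite !mxE.
  have Tk i j : i != j -> T i j = 0 by move=> /negPf ij; rewrite mxE ij.
  have -> : (T *m Z) a b = T a a * Z a b.
    rewrite mxE (bigD1 a) //= big1 ?addr0 // => k ka.
    by rewrite Tk ?mul0r // eq_sym.
  have -> : (Z *m T) a b = Z a b * T b b.
    by rewrite mxE (bigD1 b) //= big1 ?addr0 // => k kb; rewrite Tk ?mulr0.
  rewrite ![T _ _]mxE !eqxx !bracketE !eqxx (negPf ab) (negPf ba).
  by rewrite !mulr0n !mulr1n; ring.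
rewrite conn_sum ?conn_diag // conn_sum ?[proj_p _ _ _]mxE ?eqxx //.
rewrite sub0r [LHS]addrC mulNr; congr (_ + _).
rewrite -opprD -big_split -sumrN /=; apply: eq_bigr => k /andP[ka kb].
have ak : a != k by rewrite eq_sym.
have bk : b != k by rewrite eq_sym.
rewrite !conn_delta // ![proj_p _ _ _]mxE (negPf ak) (negPf kb) !bracketE.
rewrite ?(negPf ka, negPf kb, negPf ab, negPf ba, negPf ak, negPf bk, eqxx).
by rewrite !mulr0n !mulr1n /c !rmorphM /=; ring.
Qed.

(** Normalised so that the Ricci tensor is x_ij r_ij Q on p_ij; the metric is Einstein with constant
    rho as soon as all r_ij equal rho. *)
Definition ricci_coef s i j : R :=
  1 / (2 * s i j) + (\sum_(k < n | (k != i) && (k != j))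
    (s i j / (s i k * s j k) - s i k / (s i j * s j k) - s j k / (s i j * s i k)))
    / (4 * n%:R).

Lemma ricci_coefC s i j : (forall i j, s i j = s j i) ->
  ricci_coef s i j = ricci_coef s j i.
Proof.
move=> sC; rewrite /ricci_coef (sC j i); congr (_ + _ / _).
apply: eq_big => [k|k _]; first by rewrite andbC.
by rewrite [s j k * s i k]mulrC addrAC.
Qed.

Lemma sum_offdiag2 (V : nmodType) (F : 'I_n -> 'I_n -> 'I_n -> V) :
  \sum_(i < n) \sum_(j < n | j != i) \sum_(k < n | (k != i) && (k != j)) F i j k =
  \sum_(i < n) \sum_(j < n) \sum_(k < n)
    (if [&& j != i, k != i & k != j] then F i j k else 0).
Proof.
apply: eq_bigr => i _; rewrite big_mkcond /=; apply: eq_bigr => j _.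
by case: ifP => ji /=; [rewrite big_mkcond | rewrite big1].
Qed.

Lemma sum_distinct_swap (V : nmodType) (F : 'I_n -> 'I_n -> 'I_n -> V) :
  \sum_(i < n) \sum_(j < n | j != i) \sum_(k < n | (k != i) && (k != j)) F i j k =
  \sum_(i < n) \sum_(j < n | j != i) \sum_(k < n | (k != i) && (k != j)) F i k j.
Proof.
rewrite !sum_offdiag2; apply: eq_bigr => i _; rewrite exchange_big /=.
apply: eq_bigr => j _; apply: eq_bigr => k _.
by rewrite [j == k]eq_sym andbCA.
Qed.

Lemma sum_distinct_swap12 (V : nmodType) (F : 'I_n -> 'I_n -> 'I_n -> V) :
  \sum_(i < n) \sum_(j < n | j != i) \sum_(k < n | (k != i) && (k != j)) F i j k =
  \sum_(i < n) \sum_(j < n | j != i) \sum_(k < n | (k != i) && (k != j)) F j i k.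
Proof.
rewrite !sum_offdiag2 exchange_big /=.
apply: eq_bigr => j _; apply: eq_bigr => i _; apply: eq_bigr => k _.
by rewrite [i == j]eq_sym [(k != i) && _]andbC.
Qed.

Lemma ricci_coef_sum s i j : (forall i j, s i j = s j i) ->
    (forall i j, i != j -> s i j != 0) -> i != j ->
  let u i j k := conn_coef s i k j * conn_coef s j i k - conn_coef s j k i in
  - 2 + \sum_(k < n | (k != i) && (k != j)) (u i k j + u j k i)
  = - (2 * n%:R * (s i j * ricci_coef s i j)).
Proof.
move=> sC s0 ij u.
have sij := s0 _ _ ij.
have n0 : n%:R != 0 :> R by rewrite pnatr_eq0 -lt0n (leq_ltn_trans (leq0n i)).
(* Splitting n into 2 for the indices i, j and 1 for each other k makes the identity hold term by
   term in k. *)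
have nE : n%:R = 2 + \sum_(k < n | (k != i) && (k != j)) 1 :> R.
  have -> : n%:R = \sum_(k < n) 1 :> R by rewrite sumr_const card_ord.
  by rewrite (bigD1 i) //= (bigD1 j) 1?eq_sym //= addrA.
rewrite /ricci_coef; set S := (X in _ + X / _).
have -> : - (2 * n%:R * (s i j * (1 / (2 * s i j) + S / (4 * n%:R)))) =
   - n%:R - s i j / 2 * S by field; rewrite n0.
rewrite nE [- (2 + _)]opprD -[RHS]addrA; congr (_ + _).
rewrite /S mulr_sumr -sumrN -sumrB; apply: eq_bigr => k /andP[ki kj].
have ik : i != k by rewrite eq_sym.
have jk : j != k by rewrite eq_sym.
rewrite /u /conn_coef (sC k i) (sC k j) (sC j i).
have := s0 _ _ ik; have := s0 _ _ jk.
by move=> pj pi; field; rewrite sij pj pi.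
Qed.

(** The curvature trace at E_ij involves q_ij, q_ik and q_jk. Relabelling triples of distinct
    indices collects the full coefficient of each q_ij, which [ricci_coef_sum] evaluates. *)
Lemma ricci_tensor x Y Z : is_metric x -> in_p Y -> in_p Z ->
  ricci (tensor x) Y Z =
  tensor [ffun a => x a * ricci_coef (coef x) (fst_ix a) (snd_ix a)] Y Z.
Proof.
move=> x_gt0 pY pZ; have [sY Y0] := pY; have [sZ Z0] := pZ.
set s := coef x; pose q i j := Re (Y i j * Z j i).
have sC : forall i j, s i j = s j i := coef_sym x.
have s0 i j : i != j -> s i j != 0 by move=> ij; rewrite lt0r_neq0 // coef_gt0.
have qC i j : q i j = q j i by rewrite /q Re_mulC_su.
pose u i j k := conn_coef s i k j * conn_coef s j i k - conn_coef s j k i.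
pose G i j := - 2 * q i j +
  \sum_(k < n | (k != i) && (k != j)) (u i j k * q i k + u j i k * q j k).
have -> : ricci (tensor x) Y Z = \sum_(a : pairs n) G (fst_ix a) (snd_ix a) *+ 2.
  rewrite /ricci (tr_p_linear (linear_conn_curvature s Y Z)) => [|a]; last first.
    by rewrite (curvatureE x_gt0 (in_p_pvec a) pY pZ).
  apply: eq_bigr => a _; rewrite -[RHS]mulr_natl (conn_curvature_deltaE _ (neq_pair a) Y0 Z0).
  congr (_ * _); rewrite /G ReD mulNr ReN Re_double Re_sum mulNr -/(q _ _) qC.
  congr (_ + _); apply: eq_bigr => k _.
  rewrite !ReB ReD !ReZ -!/(q _ _) (qC k (fst_ix a)) (qC k (snd_ix a)) /u; ring.
rewrite sumrMnl sum_pairs -sum_offdiag_sym; last first.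
  move=> i j; rewrite /G qC; congr (_ + _).
  by apply: eq_big => [k|k _]; [rewrite andbC | rewrite addrC].
have -> : \sum_(i < n) \sum_(j < n | j != i) G i j =
   \sum_(i < n) \sum_(j < n | j != i) q i j * (- 2 +
     \sum_(k < n | (k != i) && (k != j)) (u i k j + u j k i)).
  pose f i j k := u i j k * q i k.
  (* The common value of the relabelled sums; it occurs twice before and twice after the
     collection. *)
  pose S1 := \sum_(i < n) \sum_(j < n | j != i)
    \sum_(k < n | (k != i) && (k != j)) f i j k.
  have S1E : \sum_(i < n) \sum_(j < n | j != i) \sum_(k < n | (k != i) && (k != j))
     u i k j * q i j = S1 by rewrite /S1 (sum_distinct_swap f).
  have S2E : \sum_(i < n) \sum_(j < n | j != i) \sum_(k < n | (k != i) && (k != j))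
     u j k i * q j i = S1.
    by rewrite /S1 (sum_distinct_swap f) (sum_distinct_swap12 (fun i j k => f i k j)).
  have S3E : \sum_(i < n) \sum_(j < n | j != i) \sum_(k < n | (k != i) && (k != j))
     u j i k * q j k = S1 by rewrite /S1 (sum_distinct_swap12 f).
  transitivity (\sum_(i < n) \sum_(j < n | j != i) - 2 * q i j + (S1 + S1)).
    rewrite -{2}S3E /S1 -!big_split /=; apply: eq_bigr => i _.
    rewrite -!big_split /=; apply: eq_bigr => j _.
    by rewrite -big_split.
  rewrite -{1}S1E -S2E -!big_split /=; apply: eq_bigr => i _.
  rewrite -!big_split /=; apply: eq_bigr => j _.
  rewrite -big_split /= mulrDr mulr_sumr [q i j * _]mulrC; congr (_ + _).
  by apply: eq_bigr => k _; rewrite (qC j i); ring.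
pose T i j := - (2 * n%:R * (s i j * ricci_coef s i j)) * q i j.
have -> : \sum_(i < n) \sum_(j < n | j != i) q i j * (- 2 +
     \sum_(k < n | (k != i) && (k != j)) (u i k j + u j k i)) =
   \sum_(i < n) \sum_(j < n | j != i) T i j.
  apply: eq_bigr => i _; apply: eq_bigr => j ji.
  by rewrite mulrC (ricci_coef_sum sC s0) // eq_sym.
rewrite sum_offdiag_sym -?sum_pairs => [|i j]; last first.
  by rewrite /T qC (ricci_coefC _ _ sC) (sC i j).
rewrite (tensor_su _ sY sZ) -[LHS]mulr_natl !mulr_sumr -sumrN; apply: eq_bigr => a _.
by rewrite /T ffunE -(coef_pair x a) -/s -/(q _ _); ring.
Qed.

Lemma ScE x : is_metric x ->
  Sc x = 2 * \sum_a ricci_coef (coef x) (fst_ix a) (snd_ix a).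
Proof.
move=> x_gt0; rewrite /Sc /scalar_curvature.
have x0 a : x a != 0 by apply: lt0r_neq0.
rewrite (trace_form_tensor (y := [ffun a => x a * ricci_coef (coef x) (fst_ix a) (snd_ix a)])) //.
  by congr (_ * _); apply: eq_bigr => a _; rewrite ffunE mulrC mulKf.
by move=> u; apply: ricci_tensor => //; apply: in_p_pvec.
Qed.

Lemma einsteinP x rho : is_metric x ->
  (forall a, ricci_coef (coef x) (fst_ix a) (snd_ix a) = rho) -> einstein x rho.
Proof.
move=> x_gt0 h; split=> // Y Z pY pZ; rewrite (ricci_tensor x_gt0 pY pZ).
rewrite /tensor mulr_sumr; apply: eq_bigr => a _.
by rewrite ffunE h mulrA [x a * _]mulrC.
Qed.

End Ricci.

(** * Second-order jets *)

Section Jets.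
Context {R : realType}.
Implicit Types f g : R -> R.

(** Records f(0), f'(0), f''(0) as a relation, with f' given near 0, so that jets of compound
    expressions follow by composing rules. *)
Definition jet2 f (a b c : R) : Prop :=
  f 0 = a /\ exists f' : R -> R,
    [/\ \forall t \near (0 : R), is_derive (t : R) (1 : R) f (f' t), f' 0 = b
      & is_derive (0 : R) (1 : R) f' c].

Lemma jet2_derive1n f a b c : jet2 f a b c -> derive1n 2 f 0 = c.
Proof.
case=> _ [f' [df _ df']]; rewrite /derive1n /= derive1E.
apply: (@derive_val _ _ _ _ _ _ _).
apply: near_eq_is_derive df'.
by near=> t; rewrite derive1E; apply/esym/(@derive_val _ _ _ _ _ _ _); near: t.
Unshelve. all: by end_near. Qed.

Lemma jet2_derive f : twice_differentiable_at0 f ->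
  jet2 f (f 0) (derive1 f 0) (derive1n 2 f 0).
Proof.
case=> df ddf; split; first by [].
exists (derive1 f); split; last 2 first.
- by [].
- rewrite /derive1n /= [X in is_derive _ _ _ X]derive1E; exact: derivableP.
by near=> t; rewrite derive1E; apply: derivableP; near: t.
Unshelve. all: by end_near. Qed.

Lemma jet2_cst (k : R) : jet2 (fun=> k) k 0 0.
Proof.
split=> //; exists (fun=> 0); split=> //; last exact: is_derive_cst.
by near=> t; exact: is_derive_cst.
Unshelve. all: by end_near. Qed.

Lemma jet2D f g a b c a' b' c' : jet2 f a b c -> jet2 g a' b' c' ->
  jet2 (fun t => f t + g t) (a + a') (b + b') (c + c').
Proof.
move=> [<- [f' [df <- ddf]]] [<- [g' [dg <- ddg]]]; split=> //.
exists (fun t => f' t + g' t); split=> //; last exact: is_deriveD.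
near=> t; apply: is_deriveD.
  by near: t.
by near: t.
Unshelve. all: by end_near. Qed.

Lemma jet2_sum (I : Type) (r : seq I) (P : pred I) (F : I -> R -> R) (a b c : I -> R) :
  (forall i, P i -> jet2 (F i) (a i) (b i) (c i)) ->
  jet2 (fun t => \sum_(i <- r | P i) F i t) (\sum_(i <- r | P i) a i)
    (\sum_(i <- r | P i) b i) (\sum_(i <- r | P i) c i).
Proof.
move=> jF; elim: r => [|i r IH].
  rewrite !big_nil (_ : (fun _ => _) = fun=> 0); first exact: jet2_cst.
  by apply/funext => t; rewrite big_nil.
rewrite !big_cons; case: ifPn => Pi; last first.
  rewrite (_ : (fun _ => _) = fun t => \sum_(i <- r | P i) F i t) //.
  by apply/funext => t; rewrite big_cons (negPf Pi).
rewrite (_ : (fun _ => _) = fun t => F i t + \sum_(i <- r | P i) F i t).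
  by apply: jet2D => //; exact: jF.
by apply/funext => t; rewrite big_cons Pi.
Qed.

Lemma jet2M f g a b c a' b' c' : jet2 f a b c -> jet2 g a' b' c' ->
  jet2 (fun t => f t * g t) (a * a') (a * b' + b * a')
    (a * c' + 2 * b * b' + c * a').
Proof.
move=> [<- [f' [df <- ddf]]] [<- [g' [dg <- ddg]]]; split=> //.
exists (fun t => f t * g' t + f' t * g t).
have df0 := nbhs_singleton df; have dg0 := nbhs_singleton dg.
split=> //.
  near=> t; have dft : is_derive (t : R) (1 : R) f (f' t) by near: t.
  have dgt : is_derive (t : R) (1 : R) g (g' t) by near: t.
  apply: (is_derive_eq (is_deriveM dft dgt)).
  by rewrite /GRing.scale /=; ring.
apply: (is_derive_eq (is_deriveD (is_deriveM df0 ddg) (is_deriveM ddf dg0))).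
by rewrite /GRing.scale /=; ring.
Unshelve. all: by end_near. Qed.

Lemma jet2V f a b c : (forall t, f t != 0) -> jet2 f a b c ->
  jet2 (fun t => (f t)^-1) a^-1 (- b / a ^+ 2) (2 * b ^+ 2 / a ^+ 3 - c / a ^+ 2).
Proof.
move=> f0 [<- [f' [df <- ddf]]]; split=> //.
have df0 := nbhs_singleton df.
exists (fun t => - f' t * ((f t)^-1 * (f t)^-1)); split.
- near=> t; have dft : is_derive (t : R) (1 : R) f (f' t) by near: t.
  apply: (is_derive_eq (is_deriveV (f0 t) dft)).
  by rewrite /GRing.scale /=; have := f0 t => ft; field.
- by field.
have dV := is_deriveV (f0 0) df0.
apply: (is_derive_eq (is_deriveM (is_deriveN ddf) (is_deriveM dV dV))).
by rewrite !fctE /GRing.scale /=; have := f0 0 => ft; field.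
Unshelve. all: by end_near. Qed.

(* The logarithmic 2-jet: if f = exp h, then p = h'(0) and q = h''(0). *)
Definition logjet f (a p q : R) : Prop :=
  (forall t, f t != 0) /\ jet2 f a (a * p) (a * (p ^+ 2 + q)).

Lemma logjet_neq0 f a p q : logjet f a p q -> a != 0.
Proof. by case=> f0 [<- _]. Qed.

Lemma logjetM f g a p q a' p' q' : logjet f a p q -> logjet g a' p' q' ->
  logjet (fun t => f t * g t) (a * a') (p + p') (q + q').
Proof.
move=> [f0 jf] [g0 jg]; split=> [t|]; first by rewrite mulf_neq0.
have := jet2M jf jg; congr (jet2 _ _ _ _); ring.
Qed.

Lemma logjetV f a p q : logjet f a p q -> logjet (fun t => (f t)^-1) a^-1 (- p) (- q).
Proof.
move=> jl; have a0 := logjet_neq0 jl; case: jl => f0 jf.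
split=> [t|]; first by rewrite invr_neq0.
have := jet2V f0 jf; congr (jet2 _ _ _ _); by field.
Qed.

Lemma logjet_cst (k : R) : k != 0 -> logjet (fun=> k) k 0 0.
Proof.
move=> k0; split=> //; have := jet2_cst k; congr (jet2 _ _ _ _); ring.
Qed.

Lemma logjet_prod (I : Type) (r : seq I) (F : I -> R -> R) (a p q : I -> R) :
  (forall i, logjet (F i) (a i) (p i) (q i)) ->
  logjet (fun t => \prod_(i <- r) F i t) (\prod_(i <- r) a i)
    (\sum_(i <- r) p i) (\sum_(i <- r) q i).
Proof.
move=> jF; elim: r => [|i r IH].
  rewrite !big_nil (_ : (fun _ => _) = fun=> 1); first exact/logjet_cst/oner_neq0.
  by apply/funext => t; rewrite big_nil.
rewrite !big_cons (_ : (fun _ => _) = fun t => F i t * \prod_(i <- r) F i t).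
  exact: logjetM.
by apply/funext => t; rewrite big_cons.
Qed.

Lemma jet2_inj f a b c a' b' c' : jet2 f a b c -> jet2 f a' b' c' ->
  [/\ a = a', b = b' & c = c'].
Proof.
move=> j1 j2; have c1 := jet2_derive1n j1; have c2 := jet2_derive1n j2.
case: j1 j2 => [<- [f' [df <- _]]] [<- [g' [dg <- _]]].
split=> //; last by rewrite -c1 -c2.
have df0 := nbhs_singleton df; have dg0 := nbhs_singleton dg.
by rewrite -(@derive_val _ _ _ _ _ _ _ df0) (@derive_val _ _ _ _ _ _ _ dg0).
Qed.

(** Applied to the product of the coefficients, which is constant along a curve of unit-volume
    metrics. *)
Lemma logjet_cst_eq (k a p q : R) : logjet (fun=> k) a p q -> p = 0 /\ q = 0.
Proof.
move=> jl; have a0 := logjet_neq0 jl; case: jl => _ jk.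
have [_ /esym/eqP + /esym/eqP] := jet2_inj (jet2_cst k) jk.
rewrite !mulf_eq0 !(negPf a0) /= => /eqP -> /eqP.
by rewrite expr0n /= add0r.
Qed.

End Jets.

(** * Hessian of the scalar curvature *)

Section Hessian.
Context {R : realType} {n : nat}.
Implicit Types (x u v : coeffs R n) (s w : 'I_n -> 'I_n -> R).

Local Notation sumD F := (\sum_(i < n) \sum_(j < n | j != i)
  \sum_(k < n | (k != i) && (k != j)) F i j k).

Lemma sum_distinct_rot (V : nmodType) (F : 'I_n -> 'I_n -> 'I_n -> V) :
  sumD (fun i j k => F i j k) = sumD (fun i j k => F j k i).
Proof. by rewrite (sum_distinct_swap F) (sum_distinct_swap12 (fun i j k => F i k j)). Qed.

Lemma sum_pairs_offdiag (F : 'I_n -> 'I_n -> R) : (forall i j, F i j = F j i) ->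
  2 * \sum_(a : pairs n) F (fst_ix a) (snd_ix a) =
  \sum_(i < n) \sum_(j < n | j != i) F i j.
Proof. by move=> FC; rewrite sum_offdiag_sym // sum_pairs mulr_natl. Qed.

(* With w = 1 this gives the scalar curvature, and with w the second
   logarithmic derivatives of a curve it gives the term of the second derivative
   of Sc that vanishes at an Einstein metric. *)
Lemma sum_ricci_coef s w : (forall i j, s i j = s j i) -> (forall i j, w i j = w j i) ->
  \sum_(i < n) \sum_(j < n | j != i) ricci_coef s i j * w i j =
  2^-1 * (\sum_(i < n) \sum_(j < n | j != i) (s i j)^-1 * w i j)
  + (4 * n%:R)^-1 * sumD (fun i j k =>
       s i j * ((s i k)^-1 * (s j k)^-1) * (w i j - w i k - w j k)).
Proof.
move=> sC wC; pose m i j k := s i j * ((s i k)^-1 * (s j k)^-1).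
have mC i j k : m i j k = m j i k by rewrite /m sC [X in _ * X]mulrC.
(* Relabelling gives all terms the same monomial x_ij/(x_ik x_jk) and moves the permuted indices to
   the weight w. *)
pose f i j k := m i j k * w i k.
have e1 : sumD (fun i j k => m i k j * w i j) = sumD f.
  by rewrite (sum_distinct_swap f).
have e2 : sumD (fun i j k => m j k i * w i j) = sumD f.
  rewrite (sum_distinct_rot f); apply: eq_bigr => i _; apply: eq_bigr => j _.
  by apply: eq_bigr => k _; rewrite /f (wC j i).
have e3 : sumD (fun i j k => m i j k * w j k) = sumD f.
  rewrite (sum_distinct_swap12 f); apply: eq_bigr => i _; apply: eq_bigr => j _.
  by apply: eq_bigr => k _; rewrite /f mC.
have subD (f1 f2 f3 : 'I_n -> 'I_n -> 'I_n -> R) :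
    sumD (fun i j k => f1 i j k - f2 i j k - f3 i j k) =
    sumD f1 - sumD f2 - sumD f3.
  rewrite -!sumrB; apply: eq_bigr => i _; rewrite -!sumrB; apply: eq_bigr => j _.
  by rewrite -!sumrB.
have -> : sumD (fun i j k => m i j k * (w i j - w i k - w j k)) =
   sumD (fun i j k => m i j k * w i j) - sumD f - sumD f.
  rewrite -{2}e3 -subD; apply: eq_bigr => i _; apply: eq_bigr => j _.
  by apply: eq_bigr => k _; rewrite /f !mulrBr.
rewrite -{1}e1 -e2 -subD !mulr_sumr -big_split /=; apply: eq_bigr => i _.
rewrite !mulr_sumr -big_split /=; apply: eq_bigr => j _.
rewrite /ricci_coef; set S := (X in X / (4 * _)).
have -> : \sum_(k < n | (k != i) && (k != j))
     (m i j k * w i j - m i k j * w i j - m j k i * w i j) = S * w i j.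
  rewrite mulr_suml; apply: eq_bigr => k _.
  by rewrite /m !invfM (sC k j) (sC k i) (sC j i) !mulrBl.
by rewrite mul1r invfM mulrDl -mulrA; congr (_ + _); rewrite mulrAC mulrC.
Qed.

(** The case w = 1 of [sum_ricci_coef], where 1 - 1 - 1 = -1 gives the sign. Every term is a
    monomial, to which logarithmic jets apply. *)
Lemma Sc_monomials x : is_metric x ->
  Sc x = 2^-1 * (\sum_(i < n) \sum_(j < n | j != i) (coef x i j)^-1)
  + - (4 * n%:R)^-1 * sumD (fun i j k =>
       coef x i j * ((coef x i k)^-1 * (coef x j k)^-1)).
Proof.
move=> x_gt0; have sC := coef_sym x; rewrite (ScE x_gt0).
rewrite sum_pairs_offdiag; last by move=> i j; exact: ricci_coefC.
under eq_bigr do under eq_bigr do rewrite -[ricci_coef _ _ _]mulr1.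
rewrite (@sum_ricci_coef (coef x) (fun _ _ => 1)) //.
under eq_bigr do under eq_bigr do rewrite mulr1.
congr (_ + _); rewrite mulNr -mulrN -sumrN; congr (_ * _); apply: eq_bigr => i _.
rewrite -sumrN; apply: eq_bigr => j _; rewrite -sumrN; apply: eq_bigr => k _.
by rewrite subrr sub0r mulrN1.
Qed.

(* The coefficient of exp h is multiplied by h'(0)^2 in the second derivative;
   here h = w_ij - w_ik - w_jk for the monomial x_ij / (x_ik x_jk). *)
Definition hess_form s w1 w2 : R :=
  2^-1 * (\sum_(i < n) \sum_(j < n | j != i) (s i j)^-1 * (w1 i j * w2 i j))
  - (4 * n%:R)^-1 * sumD (fun i j k => s i j * ((s i k)^-1 * (s j k)^-1) *
      ((w1 i j - w1 i k - w1 j k) * (w2 i j - w2 i k - w2 j k))).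

Lemma hess_form_linear s (r : R) w w1 w2 w3 :
  (forall i j, w i j = r * w1 i j + w2 i j) ->
  hess_form s w w3 = r * hess_form s w1 w3 + hess_form s w2 w3.
Proof.
move=> wE; rewrite /hess_form.
have -> : \sum_(i < n) \sum_(j < n | j != i) (s i j)^-1 * (w i j * w3 i j) =
  r * (\sum_(i < n) \sum_(j < n | j != i) (s i j)^-1 * (w1 i j * w3 i j)) +
  \sum_(i < n) \sum_(j < n | j != i) (s i j)^-1 * (w2 i j * w3 i j).
  rewrite mulr_sumr -big_split; apply: eq_bigr => i _.
  rewrite mulr_sumr -big_split; apply: eq_bigr => j _; rewrite wE /=; ring.
pose g w i j k := s i j * ((s i k)^-1 * (s j k)^-1) *
      ((w i j - w i k - w j k) * (w3 i j - w3 i k - w3 j k)).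
have -> : sumD (g w) = r * sumD (g w1) + sumD (g w2).
  rewrite mulr_sumr -big_split; apply: eq_bigr => i _.
  rewrite mulr_sumr -big_split; apply: eq_bigr => j _.
  rewrite mulr_sumr -big_split; apply: eq_bigr => k _; rewrite /g !wE /=; ring.
rewrite /g; ring.
Qed.

(** Every monomial has degree -1 in s; this reduces the unit-volume rescaling to g_3 itself. *)
Lemma hess_form_scale s (c : R) w1 w2 : c != 0 ->
  hess_form (fun i j => c * s i j) w1 w2 = c^-1 * hess_form s w1 w2.
Proof.
move=> c0; rewrite /hess_form mulrBr; congr (_ - _); rewrite mulrCA; congr (_ * _);
  rewrite mulr_sumr; apply: eq_bigr => i _; rewrite mulr_sumr; apply: eq_bigr => j _.
  by rewrite invfM -mulrA.
rewrite mulr_sumr; apply: eq_bigr => k _; rewrite !invfM.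
move: (s i k)^-1 (s j k)^-1 => a b; by field.
Qed.

Lemma ricci_coef_scale s (c : R) i j : c != 0 ->
  ricci_coef (fun i j => c * s i j) i j = c^-1 * ricci_coef s i j.
Proof.
move=> c0; rewrite /ricci_coef mulrDr; congr (_ + _).
  by rewrite !invfM; move: (s i j)^-1 => a; field.
rewrite mulrA; congr (_ / _); rewrite mulr_sumr; apply: eq_bigr => k _.
by rewrite !invfM; move: (s i j)^-1 (s i k)^-1 (s j k)^-1 => d a b; field.
Qed.

Lemma coef_scale (c : R) x i j : coef (c *: x) i j = c * coef x i j.
Proof.
rewrite /coef /sym_coeff; case: insubP => [a _ _|_]; first by rewrite ffunE.
by case: insubP => [a _ _|_]; rewrite ?ffunE ?mulr0.
Qed.

Lemma jet2Z (f : R -> R) (k a b c : R) : jet2 f a b c ->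
  jet2 (fun t => k * f t) (k * a) (k * b) (k * c).
Proof. by move/(jet2M (jet2_cst k)); congr (jet2 _ _ _ _); ring. Qed.

Lemma logjet_sym (c : R -> coeffs R n) (x p q : pairs n -> R) i j :
  (forall a, logjet (fun t => c t a : R) (x a) (p a) (q a)) -> i != j ->
  logjet (fun t => coef (c t) i j) (sym_coeff x i j) (sym_coeff p i j) (sym_coeff q i j).
Proof.
move=> jc ij; have [a [[<- <-]|[<- <-]]] := pairP ij; last first.
  rewrite !(sym_coeffC _ (snd_ix a)).
  rewrite (_ : (fun _ => _) = fun t => c t a : R).
    by rewrite !sym_coeff_pair.
  by apply/funext => t; rewrite coef_sym coef_pair.
rewrite (_ : (fun _ => _) = fun t => c t a : R); first by rewrite !sym_coeff_pair.
by apply/funext => t; rewrite coef_pair.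
Qed.

(** A monomial exp h contributes exp h (h'^2 + h''). The squares form [hess_form], and
    [sum_ricci_coef] with w = q collects the terms in h''. *)
Lemma Sc_second_derivative (c : R -> coeffs R n) x (p q : pairs n -> R) :
  (forall t, is_metric (c t)) ->
  (forall a, logjet (fun t => c t a : R) (x a) (p a) (q a)) ->
  derive1n 2 (fun t => Sc (c t)) 0 =
    hess_form (coef x) (sym_coeff p) (sym_coeff p)
    - 2 * \sum_a ricci_coef (coef x) (fst_ix a) (snd_ix a) * q a.
Proof.
move=> c_gt0 jc; set s := coef x; set P := sym_coeff p; set Q := sym_coeff q.
rewrite (_ : (fun t => Sc (c t)) = fun t =>
  2^-1 * (\sum_(i < n) \sum_(j < n | j != i) (coef (c t) i j)^-1)
  + - (4 * n%:R)^-1 * sumD (fun i j k =>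
      coef (c t) i j * ((coef (c t) i k)^-1 * (coef (c t) j k)^-1))); last first.
  by apply/funext => t; rewrite Sc_monomials.
have lj i j : i != j -> logjet (fun t => coef (c t) i j) (s i j) (P i j) (Q i j).
  by move=> ij; exact: logjet_sym.
have sC : forall i j, s i j = s j i := coef_sym x.
have QC i j : Q i j = Q j i by exact: sym_coeffC.
pose X1 i j := (s i j)^-1 * ((- P i j) ^+ 2 + - Q i j).
pose X2 i j k := s i j * ((s i k)^-1 * (s j k)^-1) *
  ((P i j + (- P i k + - P j k)) ^+ 2 + (Q i j + (- Q i k + - Q j k))).
transitivity (2^-1 * (\sum_(i < n) \sum_(j < n | j != i) X1 i j)
  + - (4 * n%:R)^-1 * sumD X2).
  eapply jet2_derive1n, jet2D; apply: jet2Z; apply: jet2_sum => i _;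
    apply: jet2_sum => j ji.
    by apply: (logjetV (lj _ _ _)).2; rewrite eq_sym.
  apply: jet2_sum => k /andP[ki kj].
  have ij : i != j by rewrite eq_sym.
  have ik : i != k by rewrite eq_sym.
  have jk : j != k by rewrite eq_sym.
  exact: (logjetM (lj _ _ ij) (logjetM (logjetV (lj _ _ ik)) (logjetV (lj _ _ jk)))).2.
have -> : 2 * \sum_a ricci_coef s (fst_ix a) (snd_ix a) * q a =
   \sum_(i < n) \sum_(j < n | j != i) ricci_coef s i j * Q i j.
  rewrite -sum_pairs_offdiag => [|i j]; last by rewrite (ricci_coefC _ _ sC) QC.
  by congr (_ * _); apply: eq_bigr => a _; rewrite /Q sym_coeff_pair.
rewrite (sum_ricci_coef sC QC) /hess_form.
have -> : \sum_(i < n) \sum_(j < n | j != i) X1 i j =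
  \sum_(i < n) \sum_(j < n | j != i) (s i j)^-1 * (P i j * P i j)
  - \sum_(i < n) \sum_(j < n | j != i) (s i j)^-1 * Q i j.
  rewrite -sumrB; apply: eq_bigr => i _; rewrite -sumrB; apply: eq_bigr => j _.
  by rewrite /X1; ring.
have -> : sumD X2 = sumD (fun i j k => s i j * ((s i k)^-1 * (s j k)^-1) *
      ((P i j - P i k - P j k) * (P i j - P i k - P j k)))
  + sumD (fun i j k => s i j * ((s i k)^-1 * (s j k)^-1) * (Q i j - Q i k - Q j k)).
  rewrite -big_split; apply: eq_bigr => i _; rewrite -big_split; apply: eq_bigr => j _.
  rewrite -big_split; apply: eq_bigr => k _.
  by rewrite /X2 /=; ring.
ring.
Qed.

Definition log_deriv x v : 'I_n -> 'I_n -> R := sym_coeff (fun a => (v a : R) / x a).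

Lemma log_derivP x (r : R) u v i j :
  log_deriv x (r *: u + v) i j = r * log_deriv x u i j + log_deriv x v i j.
Proof.
rewrite /log_deriv /sym_coeff; case: insubP => [a _ _|_].
  by rewrite !ffunE mulrDl -mulrA.
case: insubP => [a _ _|_]; first by rewrite !ffunE mulrDl -mulrA.
by rewrite mulr0 addr0.
Qed.

(** Constant Ricci coefficients turn the second-order term into a multiple of the sum of the [q a],
    which is the second derivative of the logarithm of the volume and hence zero. *)
Lemma einstein_hessian (v0 : R) x rho : is_metric x ->
  (forall a, ricci_coef (coef x) (fst_ix a) (snd_ix a) = rho) ->
  is_hessian v0 x
    (fun u v => hess_form (coef x) (log_deriv x u) (log_deriv x v)).
Proof.
move=> x_gt0 hr; split.
- move=> u v _ _; rewrite /hess_form; congr (_ * _ - _ * _).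
    by apply: eq_bigr => i _; apply: eq_bigr => j _; rewrite [_ * log_deriv x v _ _]mulrC.
  apply: eq_bigr => i _; apply: eq_bigr => j _; apply: eq_bigr => k _.
  by congr (_ * _); exact: mulrC.
- move=> r u u' v _ _ _; apply: hess_form_linear => i j; exact: log_derivP.
move=> v c _ [cM c0 cd cv].
have c_gt0 t : is_metric (c t) by case: (cM t).
pose p a : R := (v a : R) / x a.
(* h'' = c''/c - (c'/c)^2 for c = exp h. *)
pose q a : R := derive1n 2 (fun t => c t a : R) 0 / x a - p a ^+ 2.
have lj a : logjet (fun t => c t a : R) (x a) (p a) (q a).
  split=> [t|]; first exact: lt0r_neq0 (c_gt0 t a).
  have := jet2_derive (cd a); rewrite cv c0.
  have xa := lt0r_neq0 (x_gt0 a).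
  congr (jet2 _ _ _ _); rewrite /q /p.
    by rewrite mulrC divfK.
  by rewrite addrC subrK mulrC divfK.
have := logjet_prod (index_enum _) lj.
rewrite (_ : (fun t => \prod_a _) = fun=> v0^-1); last first.
  apply/funext => t; have [_] := cM t; rewrite volumeE // => vol1.
  have v00 : v0 != 0.
    by apply/eqP => v00; move: vol1; rewrite v00 mul0r => /esym/eqP; rewrite oner_eq0.
  by apply: (mulfI v00); rewrite vol1 divff.
move=> /logjet_cst_eq[_ q0].
rewrite (Sc_second_derivative c_gt0 lj).
under eq_bigr do rewrite hr.
by rewrite -mulr_sumr q0 !mulr0 subr0.
Qed.

End Hessian.

(** * The cubic *)

Section Cubic.
Context {R : realType}.
Implicit Types K x : R.

(** The cofactor of x - a is written as a square plus a constant. Where the constant is positive,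
    [cubic x - cubic a] has the sign of x - a, so signs of the cubic at rational points locate its
    roots. *)
Lemma cubic_diff a x : cubic x - cubic a =
  (x - a) * (14 * (x - (277 - 14 * a) / 28) ^+ 2
             + (14 * a ^+ 2 - 277 * a + 1819 - (277 - 14 * a) ^+ 2 / 56)).
Proof. by rewrite /cubic; field. Qed.

(** The ends are 7.4806 minus and plus half a unit of the last digit. *)
Lemma cubic_bounds x : cubic x = 0 ->
  7 + 48 / 100 + 55 / (100 * 1000) < x < 7 + 48 / 100 + 65 / (100 * 1000).
Proof.
move=> x_root; apply/andP; split; rewrite ltNge; apply/negP => xle.
  set a : R := 7 + 48 / 100 + 55 / (100 * 1000) in xle.
  have ca : cubic a < 0 by rewrite /cubic /a; lra.
  have da : 0 < 14 * a ^+ 2 - 277 * a + 1819 - (277 - 14 * a) ^+ 2 / 56.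
    by rewrite /a; lra.
  have := cubic_diff a x; rewrite x_root sub0r => e.
  have : - cubic a <= 0; last by lra.
  rewrite e; apply: mulr_le0_ge0; first by rewrite subr_le0.
  by apply: addr_ge0 (ltW da); apply: mulr_ge0; [lra | exact: sqr_ge0].
set a : R := 7 + 48 / 100 + 65 / (100 * 1000) in xle.
have ca : 0 < cubic a by rewrite /cubic /a; lra.
have da : 0 < 14 * a ^+ 2 - 277 * a + 1819 - (277 - 14 * a) ^+ 2 / 56.
  by rewrite /a; lra.
have := cubic_diff a x; rewrite x_root sub0r => e.
have : 0 <= - cubic a; last by lra.
rewrite e; apply: mulr_ge0; first by rewrite subr_ge0.
by apply: addr_ge0 (ltW da); apply: mulr_ge0; [lra | exact: sqr_ge0].
Qed.

Lemma cubic_exists : exists2 K : R, 0 < K & cubic K = 0.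
Proof.
pose p : {poly R} := 14%:P * 'X^3 - 277%:P * 'X^2 + 1819%:P * 'X - 3967%:P.
have pE x : p.[x] = cubic x by rewrite /p /cubic !hornerE.
have p78 : p.[7] <= 0 <= p.[8] by rewrite !pE /cubic; apply/andP; split; lra.
have le78 : (7 : R) <= 8 by lra.
have [x /andP[x7 x8]] := poly_ivt le78 p78.
by rewrite rootE pE => /eqP x_root; exists x => //; lra.
Qed.

Lemma cubic_unique x y : cubic x = 0 -> cubic y = 0 -> x = y.
Proof.
move=> cx cy.
have /andP[x1 x2] := cubic_bounds cx; have /andP[y1 y2] := cubic_bounds cy.
have : (x - y) * (14 * (x ^+ 2 + x * y + y ^+ 2) - 277 * (x + y) + 1819) =
  cubic x - cubic y by rewrite /cubic; ring.
rewrite cx cy subrr => /eqP; rewrite mulf_eq0 => /orP[|/eqP q0].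
  by rewrite subr_eq0 => /eqP.
(* 187/25 = 7.48 lies below both roots, and the cofactor is positive beyond it; the three products
   supply its quadratic terms to [lra]. *)
have xy : 0 < (x - 187 / 25) * (y - 187 / 25) by apply: mulr_gt0; lra.
have xx : 0 < (x - 187 / 25) * (x - 187 / 25) by apply: mulr_gt0; lra.
have yy : 0 < (y - 187 / 25) * (y - 187 / 25) by apply: mulr_gt0; lra.
exfalso; move: q0; rewrite !expr2; lra.
Qed.

End Cubic.

(** * Bounds and polynomial relations for the coefficients of g_3 *)

Section Coefficients.
Context {R : realType} (K : R) (K_root : cubic K = 0).
Let X := - (3967 / 5) + 237 * K - 87 / 5 * K ^+ 2.
Let Z := 41 / 5 * K ^+ 2 - 227 / 2 * K + 3967 / 10.

Lemma g3_bounds :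
  [/\ 187 / 25 < K < 15 / 2, 29 / 5 < X < 291 / 50 & 13 / 2 < Z < 131 / 20].
Proof.
have /andP[k1 k2] := cubic_bounds K_root.
(* On the interval from 7.4805 to 7.4807, [h1] bounds K^2 above by a chord and [h2] bounds it below
   by a tangent; X and Z are then estimated linearly in K. *)
have h1 : 0 < (K - (748 / 100 + 5 / (100 * 100))) * (748 / 100 + 7 / (100 * 100) - K).
  by apply: mulr_gt0; lra.
have h2 : 0 < (K - (748 / 100 + 5 / (100 * 100))) * (K - (748 / 100 + 5 / (100 * 100))).
  by apply: mulr_gt0; lra.
move: h1 h2; rewrite /X /Z !expr2 => h1 h2; split; apply/andP; split; lra.
Qed.

(** The equation r_12 = 1/20 with denominators cleared; the cofactor of [cubic K] is the quotient of
    a polynomial division. *)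
Lemma g3_rel1 : 4 * K ^+ 2 + 3 * X ^+ 2 = X * K ^+ 2.
Proof.
have : 4 * K ^+ 2 + 3 * X ^+ 2 - X * K ^+ 2 =
  cubic K * (1653 / 25 * K - 11901 / 25) by rewrite /X /cubic; field.
by rewrite K_root mul0r => /eqP; rewrite subr_eq0 => /eqP.
Qed.

(** The equation r_ij = 1/20 for i in {1, 2} and j in {3, 4, 5}; it is an identity in K. *)
Lemma g3_rel2 : 10 * K = X + 2 * Z + K ^+ 2.
Proof. by rewrite /X /Z; field. Qed.

(** The equation r_ij = 1/20 for i, j in {3, 4, 5}, again by polynomial division. *)
Lemma g3_rel3 : 5 * K ^+ 2 + 2 * Z ^+ 2 = Z * K ^+ 2.
Proof.
have : 5 * K ^+ 2 + 2 * Z ^+ 2 - Z * K ^+ 2 =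
  cubic K * (451 / 50 * K - 3967 / 50) by rewrite /Z /cubic; field.
by rewrite K_root mul0r => /eqP; rewrite subr_eq0 => /eqP.
Qed.

End Coefficients.

(** * Five indices *)

Section Five.
Context {R : realType}.

(** A symmetric function on edges given by cases, so that sums over five indices reduce by
    computation. The names count vertices from 1, the indices from 0. *)
Definition edge5 (x12 x13 x14 x15 x23 x24 x25 x34 x35 x45 : R) (i j : 'I_5) : R :=
  match nat_of_ord i, nat_of_ord j with
  | 0, 1 | 1, 0 => x12 | 0, 2 | 2, 0 => x13 | 0, 3 | 3, 0 => x14
  | 0, 4 | 4, 0 => x15 | 1, 2 | 2, 1 => x23 | 1, 3 | 3, 1 => x24
  | 1, 4 | 4, 1 => x25 | 2, 3 | 3, 2 => x34 | 2, 4 | 4, 2 => x35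
  | 3, 4 | 4, 3 => x45 | _, _ => 0%R
  end%N.

Lemma ord5_ind (P : 'I_5 -> Prop) :
  P (inord 0) -> P (inord 1) -> P (inord 2) -> P (inord 3) -> P (inord 4) ->
  forall i, P i.
Proof.
move=> P0 P1 P2 P3 P4 i; rewrite -(inord_val i).
by case: i => [[|[|[|[|[|i]]]]] hi].
Qed.

Lemma edge5_sym x12 x13 x14 x15 x23 x24 x25 x34 x35 x45 i j :
  edge5 x12 x13 x14 x15 x23 x24 x25 x34 x35 x45 i j =
  edge5 x12 x13 x14 x15 x23 x24 x25 x34 x35 x45 j i.
Proof.
by case: i => [[|[|[|[|[|i]]]]] hi]; case: j => [[|[|[|[|[|j]]]]] hj].
Qed.

Lemma sum_ord5 (V : nmodType) (F : 'I_5 -> V) :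
  \sum_i F i = F (inord 0) + (F (inord 1) + (F (inord 2) + (F (inord 3) + F (inord 4)))).
Proof.
rewrite !big_ord_recl big_ord0 addr0.
by congr (F _ + (F _ + (F _ + (F _ + F _)))); apply: val_inj; rewrite /= inordK.
Qed.

Lemma sym_edge5 (w : 'I_5 -> 'I_5 -> R) : (forall i j, w i j = w j i) ->
  (forall i, w i i = 0) ->
  w = edge5 (w (inord 0) (inord 1)) (w (inord 0) (inord 2)) (w (inord 0) (inord 3))
    (w (inord 0) (inord 4)) (w (inord 1) (inord 2)) (w (inord 1) (inord 3))
    (w (inord 1) (inord 4)) (w (inord 2) (inord 3)) (w (inord 2) (inord 4))
    (w (inord 3) (inord 4)).
Proof.
move=> wC w0; apply/funext => i; apply/funext => j.
by elim/ord5_ind: i; elim/ord5_ind: j; rewrite /edge5 !inordK //= wC.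
Qed.

Lemma coef_lex5 x12 x13 x14 x15 x23 x24 x25 x34 x35 x45 :
  coef (lex_coeffs 5 [:: x12; x13; x14; x15; x23; x24; x25; x34; x35; x45]) =
  edge5 x12 x13 x14 x15 x23 x24 x25 x34 x35 x45.
Proof.
apply/funext => i; apply/funext => j.
have [->|/pairP[a ij]] := eqVneq i j.
  by rewrite coefii; case: j => [[|[|[|[|[|j]]]]] hj].
suff e : coef (lex_coeffs 5 [:: x12; x13; x14; x15; x23; x24; x25; x34; x35; x45])
      (fst_ix a) (snd_ix a) =
    edge5 x12 x13 x14 x15 x23 x24 x25 x34 x35 x45 (fst_ix a) (snd_ix a).
  by case: ij => [[<- <-]|[<- <-]] //; rewrite coef_sym e edge5_sym.
rewrite coef_pair ffunE; have := ltn_pair a; move: (fst_ix a) (snd_ix a) => k l.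
by case: k => [[|[|[|[|[|k]]]]] hk]; case: l => [[|[|[|[|[|l]]]]] hl].
Qed.

Lemma edge5_ricci (X K Z : R) : X != 0 -> K != 0 -> Z != 0 ->
  4 * K ^+ 2 + 3 * X ^+ 2 = X * K ^+ 2 -> 10 * K = X + 2 * Z + K ^+ 2 ->
  5 * K ^+ 2 + 2 * Z ^+ 2 = Z * K ^+ 2 ->
  forall i j, i != j -> ricci_coef (edge5 X K K K K K K Z Z Z) i j = 1 / 20.
Proof.
move=> X0 K0 Z0 e1 e2 e3 i j.
(* One equation for each orbit of edges: 12, the six edges between the blocks, the three inside {3,
   4, 5}. *)
have r1 : 1 / 5 / X + 3 / 20 * X / K ^+ 2 = 1 / 20.
  have : X * K ^+ 2 / (20 * X * K ^+ 2) = 1 / 20 by field; rewrite X0 K0.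
  by rewrite -e1 => <-; field; rewrite X0 K0.
have r2 : 1 / 2 / K - X / 20 / K ^+ 2 - Z / 10 / K ^+ 2 = 1 / 20.
  have -> : 1 / 2 / K = 10 * K / 20 / K ^+ 2 by field.
  by rewrite e2; field.
have r3 : 1 / 4 / Z + Z / 10 / K ^+ 2 = 1 / 20.
  have : Z * K ^+ 2 / (20 * Z * K ^+ 2) = 1 / 20 by field; rewrite Z0 K0.
  by rewrite -e3 => <-; field; rewrite Z0 K0.
rewrite /ricci_coef big_mkcond sum_ord5.
elim/ord5_ind: i; elim/ord5_ind: j; rewrite -!val_eqE /edge5 /= !inordK //= => _.
all: rewrite ?add0r ?addr0.
all: try by rewrite -r1; field; rewrite X0 K0.
all: try by rewrite -r2; field; rewrite ?X0 ?K0 ?Z0.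
all: by rewrite -r3; field; rewrite ?X0 ?K0 ?Z0.
Qed.

Lemma sum_neq5 (V : nmodType) (i : 'I_5) (F : 'I_5 -> V) :
  \sum_(j < 5 | j != i) F j = \sum_j (if j != i then F j else 0).
Proof. exact: big_mkcond. Qed.

Lemma sum_neq2_5 (V : nmodType) (i j : 'I_5) (F : 'I_5 -> V) :
  \sum_(k < 5 | (k != i) && (k != j)) F k =
  \sum_k (if (k != i) && (k != j) then F k else 0).
Proof. exact: big_mkcond. Qed.

(* The isotypic components of w under S_2 x S_3: b and c are the means over the
   edges between the two blocks and inside {3, 4, 5}, s is the sign component,
   t + g and g are the components of type the standard representation of S_3 on
   these two sets of edges, and o is the component of its twist by the sign.
   The involution J changes the signs of g and o.  Coordinates of t, g, o at
   vertex 5 are minus the sums of the two others. *)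
Definition wpar (b c s t3 t4 g3 g4 o3 o4 : R) : 'I_5 -> 'I_5 -> R :=
  edge5 (- 6 * b - 3 * c)
    (b + s + t3 + g3 + o3) (b + s + t4 + g4 + o4)
    (b + s - t3 - t4 - g3 - g4 - o3 - o4)
    (b - s + t3 + g3 - o3) (b - s + t4 + g4 - o4)
    (b - s - t3 - t4 - g3 - g4 + o3 + o4)
    (c - g3 - g4) (c + g4) (c + g3).

(** Different isotypic components do not mix. Within one type, t and g do not mix either: by
    symmetry of the form, the cross terms between the two eigenspaces of J cancel in H(u, J u). *)
Lemma hess_wpar (X K Z : R) b c s t3 t4 g3 g4 o3 o4 : X != 0 -> K != 0 -> Z != 0 ->
  hess_form (edge5 X K K K K K K Z Z Z) (wpar b c s t3 t4 g3 g4 o3 o4)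
    (wpar b c s t3 t4 (- g3) (- g4) (- o3) (- o4)) =
  let A := 2 / K - (4 * (X / K ^+ 2) + 2 * (Z / K ^+ 2) + 12 / Z) / 10 in
  let D := A - 4 / 10 * (Z / K ^+ 2) + 2 / 10 / Z - 2 / 10 * (Z / K ^+ 2) in
  let O := 2 / K - (8 / X + 2 * (Z / K ^+ 2) + 12 / Z) / 10 in
  let al := - 6 * b - 3 * c in
  4 / 10 * al ^+ 2 / X + 6 / K * b ^+ 2 + 15 / 10 / Z * c ^+ 2
  - 3 / 10 * (X / K ^+ 2) * (al - 2 * b) ^+ 2 - 6 / 10 * (Z / K ^+ 2) * (c - 2 * b) ^+ 2
  + (6 / K - 24 / 10 / X - 24 / 10 * (Z / K ^+ 2)) * s ^+ 2
  + A * (t3 ^+ 2 + t4 ^+ 2 + (t3 + t4) ^+ 2)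
  - D * (g3 ^+ 2 + g4 ^+ 2 + (g3 + g4) ^+ 2)
  - O * (o3 ^+ 2 + o4 ^+ 2 + (o3 + o4) ^+ 2).
Proof.
move=> X0 K0 Z0; rewrite /hess_form.
rewrite !(sum_neq5, sum_neq2_5, sum_ord5).
rewrite -!val_eqE /=.
rewrite !inordK //=.
rewrite /wpar /edge5. rewrite !inordK //=.
by field; rewrite X0 K0 Z0.
Qed.

(* The form in (b, c) is handled by AM-GM with weights 5/6 and 3/5, whose product
   is 1/2. *)
Lemma hess_wpar_pos (X K Z : R) b c s t3 t4 g3 g4 o3 o4 :
  187 / 25 < K < 15 / 2 -> 29 / 5 < X < 291 / 50 -> 13 / 2 < Z < 131 / 20 ->
  (b ^+ 2 + c ^+ 2 + s ^+ 2 + t3 ^+ 2 + t4 ^+ 2 + g3 ^+ 2 + g4 ^+ 2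
   + o3 ^+ 2 + o4 ^+ 2) / 100 <=
  hess_form (edge5 X K K K K K K Z Z Z) (wpar b c s t3 t4 g3 g4 o3 o4)
    (wpar b c s t3 t4 (- g3) (- g4) (- o3) (- o4)).
Proof.
move=> /andP[K1 K2] /andP[X1 X2] /andP[Z1 Z2].
have K0 : 0 < K by lra.
have X0 : 0 < X by lra.
have Z0 : 0 < Z by lra.
have KK1 : 559 / 10 < K ^+ 2.
  have : 187 / 25 * (187 / 25) < K * K by apply: ltr_pM; lra.
  rewrite expr2; lra.
have KK2 : K ^+ 2 < 225 / 4.
  have : K * K < 15 / 2 * (15 / 2) by apply: ltr_pM; lra.
  rewrite expr2; lra.
have KK0 : 0 < K ^+ 2 by lra.
rewrite hess_wpar ?lt0r_neq0 //=.
have iK1 : 2 / 15 < K^-1 by rewrite -[K^-1]mul1r ltr_pdivlMr //; lra.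
have iK2 : K^-1 < 25 / 187 by rewrite -[K^-1]mul1r ltr_pdivrMr //; lra.
have iX1 : 50 / 291 < X^-1 by rewrite -[X^-1]mul1r ltr_pdivlMr //; lra.
have iX2 : X^-1 < 5 / 29 by rewrite -[X^-1]mul1r ltr_pdivrMr //; lra.
have iZ1 : 20 / 131 < Z^-1 by rewrite -[Z^-1]mul1r ltr_pdivlMr //; lra.
have iZ2 : Z^-1 < 2 / 13 by rewrite -[Z^-1]mul1r ltr_pdivrMr //; lra.
have p1 : 10 / 97 < X / K ^+ 2 by rewrite ltr_pdivlMr //; lra.
have p2 : X / K ^+ 2 < 5 / 48 by rewrite ltr_pdivrMr //; lra.
have r1 : 3 / 26 < Z / K ^+ 2 by rewrite ltr_pdivlMr //; lra.
have r2 : Z / K ^+ 2 < 2 / 17 by rewrite ltr_pdivrMr //; lra.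
(* The form is linear in these five quotients, so their rational bounds suffice and X, K, Z can be
   forgotten. *)
move: (X / K ^+ 2) (Z / K ^+ 2) K^-1 X^-1 Z^-1 p1 p2 r1 r2 iK1 iK2 iX1 iX2 iZ1 iZ2.
move=> p r iK iX iZ p1 p2 r1 r2 iK1 iK2 iX1 iX2 iZ1 iZ2.
move=> {K1 K2 X1 X2 Z1 Z2 K0 X0 Z0 KK1 KK2 KK0}.
set O := 2 * iK - _ / 10; set A := 2 * iK - _ / 10; set S := 6 * iK - _ - _.
set D := A - _ + _ - _.
have hA : 1 / 100 <= A by rewrite /A; lra.
have hD : D <= - (1 / 100) by rewrite /D /A; lra.
have hO : O <= - (1 / 100) by rewrite /O; lra.
have hS : 1 / 100 <= S by rewrite /S; lra.
(* Coefficients of b^2, c^2 and bc in the invariant block. *)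
pose tb := 144 / 10 * iX + 6 * iK - 192 / 10 * p - 24 / 10 * r.
pose tc := 36 / 10 * iX + 15 / 10 * iZ - 27 / 10 * p - 6 / 10 * r.
pose tm := 144 / 10 * iX - 144 / 10 * p + 24 / 10 * r.
have hb : 49 / 50 <= tb by rewrite /tb; lra.
have hc : 49 / 100 <= tc by rewrite /tc; lra.
have hm1 : 0 <= tm by rewrite /tm; lra.
have hm2 : tm <= 13 / 10 by rewrite /tm; lra.
have -> : 4 / 10 * (- 6 * b - 3 * c) ^+ 2 * iX + 6 * iK * b ^+ 2
    + 15 / 10 * iZ * c ^+ 2 - 3 / 10 * p * (- 6 * b - 3 * c - 2 * b) ^+ 2
    - 6 / 10 * r * (c - 2 * b) ^+ 2 = tb * b ^+ 2 + tm * (b * c) + tc * c ^+ 2.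
  by rewrite /tb /tm /tc; field.
move: tb tc tm A D O S hb hc hm1 hm2 hA hD hO hS => tb tc tm A D O S.
move=> {p r iK iX iZ p1 p2 r1 r2 iK1 iK2 iX1 iX2 iZ1 iZ2} hb hc hm1 hm2 hA hD hO hS.
have sq3 (k u v : R) : 1 / 100 <= k ->
    (u ^+ 2 + v ^+ 2) / 100 <= k * (u ^+ 2 + v ^+ 2 + (u + v) ^+ 2).
  move=> hk; have u0 := sqr_ge0 u; have v0 := sqr_ge0 v; have uv := sqr_ge0 (u + v).
  have : 0 <= (k - 1 / 100) * (u ^+ 2 + v ^+ 2 + (u + v) ^+ 2).
    by apply: mulr_ge0; lra.
  lra.
have hT := sq3 _ t3 t4 hA.
have hG : (g3 ^+ 2 + g4 ^+ 2) / 100 <= - D * (g3 ^+ 2 + g4 ^+ 2 + (g3 + g4) ^+ 2).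
  by apply: sq3; lra.
have hOo : (o3 ^+ 2 + o4 ^+ 2) / 100 <= - O * (o3 ^+ 2 + o4 ^+ 2 + (o3 + o4) ^+ 2).
  by apply: sq3; lra.
have hs : s ^+ 2 / 100 <= S * s ^+ 2.
  have : 0 <= (S - 1 / 100) * s ^+ 2 by apply: mulr_ge0; [lra | exact: sqr_ge0].
  lra.
have hbc : (b ^+ 2 + c ^+ 2) / 100 <= tb * b ^+ 2 + tm * (b * c) + tc * c ^+ 2.
  have b0 : 0 <= (tb - 49 / 50) * b ^+ 2 by apply: mulr_ge0; [lra | exact: sqr_ge0].
  have c0 : 0 <= (tc - 49 / 100) * c ^+ 2 by apply: mulr_ge0; [lra | exact: sqr_ge0].
  (* As 2 (5/6)(3/5) = 1, this square bounds tm bc from below, and [m2] replaces tm by 13/10. The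
     loss is affordable: 13/10 * 25/36 < 97/100 and 13/10 * 9/25 < 48/100. *)
  have m1 : 0 <= tm * (5 / 6 * b + 3 / 5 * c) ^+ 2.
    by apply: mulr_ge0; [lra | exact: sqr_ge0].
  have m2 : 0 <= (13 / 10 - tm) * ((5 / 6) ^+ 2 * b ^+ 2 + (3 / 5) ^+ 2 * c ^+ 2).
    by apply: mulr_ge0; first lra; apply: addr_ge0; apply: mulr_ge0; exact: sqr_ge0.
  have q0 := sqr_ge0 b; have q1 := sqr_ge0 c.
  lra.
lra.
Qed.

End Five.

(** * Tangent vectors in logarithmic coordinates, and the unit-volume rescaling *)

Section LogCoordinates.
Context {R : realType} {n : nat}.
Implicit Types (x y u v : coeffs R n) (w : 'I_n -> 'I_n -> R).

Definition from_log y w : coeffs R n :=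
  [ffun a => (y a : R) * w (fst_ix a) (snd_ix a)].

Lemma log_derivC y u i j : log_deriv y u i j = log_deriv y u j i.
Proof. exact: sym_coeffC. Qed.

Lemma log_derivii y u i : log_deriv y u i i = 0.
Proof. exact: sym_coeffii. Qed.

Lemma from_logK y w : is_metric y -> (forall i j, w i j = w j i) ->
  (forall i, w i i = 0) -> log_deriv y (from_log y w) = w.
Proof.
move=> y_gt0 wC w0; apply/funext => i; apply/funext => j.
have [->|/pairP[a ij]] := eqVneq i j; first by rewrite log_derivii w0.
suff e : log_deriv y (from_log y w) (fst_ix a) (snd_ix a) = w (fst_ix a) (snd_ix a).
  by case: ij => [[<- <-]|[<- <-]]; rewrite // log_derivC e wC.
by rewrite /log_deriv sym_coeff_pair ffunE mulrAC divff ?mul1r ?lt0r_neq0.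
Qed.

Lemma log_derivK y u : is_metric y -> from_log y (log_deriv y u) = u.
Proof.
move=> y_gt0; apply/ffunP => a; rewrite ffunE /log_deriv sym_coeff_pair.
by rewrite mulrC divfK ?lt0r_neq0.
Qed.

Lemma TT_log_deriv y u : is_metric y ->
  TT y u <-> \sum_(a : pairs n) log_deriv y u (fst_ix a) (snd_ix a) = 0.
Proof.
move=> y_gt0; rewrite TT_sum //.
by under [X in _ <-> X = _]eq_bigr do rewrite /log_deriv sym_coeff_pair.
Qed.

(** Scaling by c multiplies the volume by c^N, with N the number of pairs, so c is an N-th root;
    [a0] ensures N > 0. *)
Lemma unit_rescaling_exists (v0 : R) x (a0 : pairs n) : 0 < v0 -> is_metric x ->
  exists2 c : R, 0 < c & volume v0 (c *: x) = 1.
Proof.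
move=> v0_gt0 x_gt0; set P := v0 * \prod_a (x a : R).
have P_gt0 : 0 < P by rewrite mulr_gt0 // prodr_gt0.
pose N := #|{: pairs n}|.
have N_gt0 : (0 < N)%N by apply/card_gt0P; exists a0.
pose c := P^-1 `^ N%:R^-1.
have c_gt0 : 0 < c by rewrite powR_gt0 ?invr_gt0.
exists c => //; rewrite volumeE => [|a]; last by rewrite ffunE mulr_gt0.
under eq_bigr do rewrite ffunE.
rewrite big_split /= prodr_const mulrCA -/P -powR_mulrn ?ltW // -powRrM mulVf.
  by rewrite powRr1 ?mulVf ?lt0r_neq0 // ltW // invr_gt0.
by rewrite pnatr_eq0 -lt0n.
Qed.

End LogCoordinates.

(** * Isotypic coordinates on the tangent space for n = 5, and the geometry of g_3 *)

Section WPar.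
Context {R : realType}.
Implicit Types w : 'I_5 -> 'I_5 -> R.

Local Notation ent w i j := (w (inord i%N : 'I_5) (inord j%N : 'I_5)).

Lemma sum_pairs5 w :
  \sum_(a : pairs 5) w (fst_ix a) (snd_ix a) =
  ent w 0 1 + ent w 0 2 + ent w 0 3 + ent w 0 4 + ent w 1 2 + ent w 1 3 + ent w 1 4
  + ent w 2 3 + ent w 2 4 + ent w 3 4.
Proof.
rewrite sum_pairs sum_ord5 !(big_mkcond (fun j : 'I_5 => (_ < j)%N)) /= !sum_ord5.
by rewrite !inordK //= !add0r !addr0 !addrA.
Qed.

(** The functionals from [par_b] to [par_t4] read off the coordinates along the +1 eigenspace of J;
    on the tangent space their common kernel is the -1 eigenspace. *)
Definition par_b w : R :=
  (ent w 0 2 + ent w 0 3 + ent w 0 4 + ent w 1 2 + ent w 1 3 + ent w 1 4) / 6.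
Definition par_c w : R := (ent w 2 3 + ent w 2 4 + ent w 3 4) / 3.
Definition par_s w : R :=
  (ent w 0 2 + ent w 0 3 + ent w 0 4 - ent w 1 2 - ent w 1 3 - ent w 1 4) / 6.
(** The half-sum at the vertex is b + t + g, and the inner edge opposite to it carries c + g. *)
Definition par_t3 w : R := (ent w 0 2 + ent w 1 2) / 2 - par_b w - ent w 3 4 + par_c w.
Definition par_t4 w : R := (ent w 0 3 + ent w 1 3) / 2 - par_b w - ent w 2 4 + par_c w.

(** The vanishing sum forces the entry of edge 12 to be -6b - 3c; the remaining coordinates are read
    off from the other edges. *)
Lemma wpar_surj w : (forall i j, w i j = w j i) -> (forall i, w i i = 0) ->
  \sum_(a : pairs 5) w (fst_ix a) (snd_ix a) = 0 ->
  exists g3 g4 o3 o4,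
    w = wpar (par_b w) (par_c w) (par_s w) (par_t3 w) (par_t4 w) g3 g4 o3 o4.
Proof.
move=> wC w0; rewrite sum_pairs5 => sum0.
exists (ent w 3 4 - par_c w), (ent w 2 4 - par_c w),
  ((ent w 0 2 - ent w 1 2) / 2 - par_s w), ((ent w 0 3 - ent w 1 3) / 2 - par_s w).
rewrite {1}(sym_edge5 wC w0) /wpar /par_t3 /par_t4 /par_b /par_c /par_s.
by congr edge5; lra.
Qed.

Lemma wpar_sym b c s t3 t4 g3 g4 o3 o4 i j :
  wpar b c s t3 t4 g3 g4 o3 o4 i j = wpar b c s t3 t4 g3 g4 o3 o4 j i :> R.
Proof. exact: edge5_sym. Qed.

Lemma wpar_diag b c s t3 t4 g3 g4 o3 o4 i :
  wpar b c s t3 t4 g3 g4 o3 o4 i i = 0 :> R.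
Proof. by case: i => [[|[|[|[|[|i]]]]] hi]. Qed.

Lemma wpar_sum b c s t3 t4 g3 g4 o3 o4 :
  \sum_(a : pairs 5) wpar b c s t3 t4 g3 g4 o3 o4 (fst_ix a) (snd_ix a) = 0 :> R.
Proof. by rewrite sum_pairs5 /wpar /edge5 !inordK //=; ring. Qed.

Lemma wpar_linear (r : R) b c s t3 t4 g3 g4 o3 o4 b' c' s' t3' t4' g3' g4' o3' o4' i j :
  wpar (r * b + b') (r * c + c') (r * s + s') (r * t3 + t3') (r * t4 + t4')
    (r * g3 + g3') (r * g4 + g4') (r * o3 + o3') (r * o4 + o4') i j =
  r * wpar b c s t3 t4 g3 g4 o3 o4 i j + wpar b' c' s' t3' t4' g3' g4' o3' o4' i j.
Proof.
elim/ord5_ind: i; elim/ord5_ind: j; rewrite /wpar /edge5 !inordK //=; ring.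
Qed.

Lemma wpar0 i j : wpar 0 0 0 0 0 0 0 0 0 i j = 0 :> R.
Proof.
elim/ord5_ind: i; elim/ord5_ind: j; rewrite /wpar /edge5 !inordK //=; ring.
Qed.

Lemma g3E (K : R) : coef (g3 K) =
  let X := - (3967 / 5) + 237 * K - 87 / 5 * K ^+ 2 in
  let Z := 41 / 5 * K ^+ 2 - 227 / 2 * K + 3967 / 10 in
  edge5 X K K K K K K Z Z Z.
Proof. exact: coef_lex5. Qed.

Lemma g3_metric (K : R) : cubic K = 0 -> is_metric (g3 K).
Proof.
move=> /g3_bounds[/andP[K0 _] /andP[X0 _] /andP[Z0 _]] a.
rewrite -coef_pair g3E /=.
have pos (p q : R) : 0 <= p -> p < q -> 0 < q by exact: le_lt_trans.
have {}K0 := pos _ _ _ K0; have {}X0 := pos _ _ _ X0; have {}Z0 := pos _ _ _ Z0.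
have {}K0 : 0 < K by apply: K0; lra.
have {}X0 : 0 < - (3967 / 5) + 237 * K - 87 / 5 * K ^+ 2 by apply: X0; lra.
have {}Z0 : 0 < 41 / 5 * K ^+ 2 - 227 / 2 * K + 3967 / 10 by apply: Z0; lra.
have := ltn_pair a; move: (fst_ix a) (snd_ix a) => k l.
by case: k => [[|[|[|[|[|k]]]]] hk]; case: l => [[|[|[|[|[|l]]]]] hl].
Qed.

Lemma g3_ricci (K : R) i j : cubic K = 0 -> i != j ->
  ricci_coef (coef (g3 K)) i j = 1 / 20.
Proof.
move=> K_root ij; rewrite g3E /=.
have [/andP[K0 _] /andP[X0 _] /andP[Z0 _]] := g3_bounds K_root.
apply: edge5_ricci ij; last 1 first.
- exact: g3_rel3.
- by apply/lt0r_neq0/(lt_trans _ X0); lra.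
- by apply/lt0r_neq0/(lt_trans _ K0); lra.
- by apply/lt0r_neq0/(lt_trans _ Z0); lra.
- exact: g3_rel1.
- exact: g3_rel2.
Qed.

End WPar.

(** * Index of the metric *)

Section Index.
Context {R : realType} (v0 K k : R) (K_root : cubic K = 0) (k_gt0 : 0 < k).
Let y : coeffs R 5 := k *: g3 K.
Let H (u v : coeffs R 5) : R := hess_form (coef y) (log_deriv y u) (log_deriv y v).

Lemma rescaled_metric : is_metric y.
Proof. by move=> a; rewrite ffunE mulr_gt0 ?g3_metric. Qed.

Lemma rescaled_hessian : is_hessian v0 y H.
Proof.
apply: (@einstein_hessian R 5 v0 y (k^-1 * (1 / 20))); first exact: rescaled_metric.
move=> a; have -> : coef y = fun i j => k * coef (g3 K) i j.
  by apply/funext => i; apply/funext => j; exact: coef_scale.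
by rewrite ricci_coef_scale ?lt0r_neq0 // g3_ricci // neq_pair.
Qed.

Lemma rescaled_TT_wpar b c s t3 t4 g3 g4 o3 o4 : TT y (from_log y (wpar b c s t3 t4 g3 g4 o3 o4)).
Proof.
apply/(TT_log_deriv _ rescaled_metric); rewrite from_logK ?wpar_sum //.
- exact: rescaled_metric.
- exact: wpar_sym.
- exact: wpar_diag.
Qed.

(** The inequality for H(u, J u) at g_3, divided by k by homogeneity. *)
Lemma hessian_pairing_lower b c s t3 t4 g3 g4 o3 o4 :
  (b ^+ 2 + c ^+ 2 + s ^+ 2 + t3 ^+ 2 + t4 ^+ 2 + g3 ^+ 2 + g4 ^+ 2
   + o3 ^+ 2 + o4 ^+ 2) / 100 / k <=
  H (from_log y (wpar b c s t3 t4 g3 g4 o3 o4))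
    (from_log y (wpar b c s t3 t4 (- g3) (- g4) (- o3) (- o4))).
Proof.
rewrite /H !(from_logK rescaled_metric (wpar_sym _ _ _ _ _ _ _ _ _) (wpar_diag _ _ _ _ _ _ _ _ _)).
have -> : coef y = fun i j => k * coef (Defs.g3 K) i j.
  by apply/funext => i; apply/funext => j; exact: coef_scale.
rewrite hess_form_scale ?lt0r_neq0 // [_ / k]mulrC ler_pM2l ?invr_gt0 // g3E /=.
by have [] := g3_bounds K_root; exact: hess_wpar_pos.
Qed.

Lemma hessian_pairing_le0 b c s t3 t4 g3 g4 o3 o4 :
  H (from_log y (wpar b c s t3 t4 g3 g4 o3 o4))
    (from_log y (wpar b c s t3 t4 (- g3) (- g4) (- o3) (- o4))) <= 0 ->
  from_log y (wpar b c s t3 t4 g3 g4 o3 o4) = 0 /\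
  [/\ b = 0, c = 0, s = 0, t3 = 0 & t4 = 0].
Proof.
move=> /(le_trans (hessian_pairing_lower _ _ _ _ _ _ _ _ _)).
rewrite pmulr_lle0 ?invr_gt0 // pmulr_lle0 ?invr_gt0 // => sum_le0.
have b2 := sqr_ge0 b; have c2 := sqr_ge0 c; have s2 := sqr_ge0 s.
have t32 := sqr_ge0 t3; have t42 := sqr_ge0 t4; have g32 := sqr_ge0 g3.
have g42 := sqr_ge0 g4; have o32 := sqr_ge0 o3; have o42 := sqr_ge0 o4.
have sq0 (z : R) : z ^+ 2 <= 0 -> z = 0.
  by move=> z2; apply/eqP; rewrite -sqrf_eq0 eq_le z2 sqr_ge0.
have -> : b = 0 by apply: sq0; lra.
have -> : c = 0 by apply: sq0; lra.
have -> : s = 0 by apply: sq0; lra.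
have -> : t3 = 0 by apply: sq0; lra.
have -> : t4 = 0 by apply: sq0; lra.
have -> : g3 = 0 by apply: sq0; lra.
have -> : g4 = 0 by apply: sq0; lra.
have -> : o3 = 0 by apply: sq0; lra.
have -> : o4 = 0 by apply: sq0; lra.
by split=> //; apply/ffunP => a; rewrite !ffunE wpar0 mulr0.
Qed.

Lemma rescaled_TT_wpar_surj u : TT y u -> exists g3 g4 o3 o4,
  u = from_log y (wpar (par_b (log_deriv y u)) (par_c (log_deriv y u))
    (par_s (log_deriv y u)) (par_t3 (log_deriv y u)) (par_t4 (log_deriv y u)) g3 g4 o3 o4).
Proof.
move=> /(TT_log_deriv _ rescaled_metric) u0.
have [g3 [g4 [o3 [o4 uE]]]] := wpar_surj (log_derivC y u) (log_derivii y u) u0.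
by exists g3, g4, o3, o4; rewrite -uE log_derivK //; exact: rescaled_metric.
Qed.

(** A vector u in the kernel pairs to zero with J u, which forces u = 0. *)
Lemma rescaled_nondegenerate : G_nondegenerate v0 y.
Proof.
exists H; first exact: rescaled_hessian.
move=> u /rescaled_TT_wpar_surj[g3 [g4 [o3 [o4 ->]]]] u_ker.
set b := par_b _ in u_ker *; set c := par_c _ in u_ker *; set s := par_s _ in u_ker *.
set t3 := par_t3 _ in u_ker *; set t4 := par_t4 _ in u_ker *.
have := u_ker _ (rescaled_TT_wpar b c s t3 t4 (- g3) (- g4) (- o3) (- o4)).
by move=> H0; case: (@hessian_pairing_le0 b c s t3 t4 g3 g4 o3 o4); rewrite ?H0.
Qed.

(** Parametrises the +1 eigenspace of J, where H(u, u) = H(u, J u). *)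
Definition pos_embed (r : 'rV[R]_5) : coeffs R 5 :=
  from_log y (wpar (r 0 (inord 0)) (r 0 (inord 1)) (r 0 (inord 2))
    (r 0 (inord 3)) (r 0 (inord 4)) 0 0 0 0).

Lemma pos_embed_linear : linear pos_embed.
Proof.
move=> a r r'; apply/ffunP => p; rewrite !ffunE !mxE.
have := @wpar_linear R a (r 0 (inord 0)) (r 0 (inord 1)) (r 0 (inord 2))
    (r 0 (inord 3)) (r 0 (inord 4)) 0 0 0 0 (r' 0 (inord 0)) (r' 0 (inord 1))
    (r' 0 (inord 2)) (r' 0 (inord 3)) (r' 0 (inord 4)) 0 0 0 0 (fst_ix p) (snd_ix p).
rewrite !mulr0 !addr0 => ->.
by rewrite mulrDr mulrCA.
Qed.

Lemma hessian_pos_embed r : H (pos_embed r) (pos_embed r) <= 0 -> r = 0.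
Proof.
move=> H_le0.
have [|_ [r0 r1 r2 r3 r4]] := @hessian_pairing_le0 (r 0 (inord 0)) (r 0 (inord 1)) (r 0 (inord 2))
    (r 0 (inord 3)) (r 0 (inord 4)) 0 0 0 0; first by rewrite oppr0.
by apply/rowP => i; rewrite [RHS]mxE; elim/ord5_ind: i.
Qed.

Lemma rescaled_TT0 : TT y 0.
Proof.
apply/TT_sum; first exact: rescaled_metric.
by rewrite big1 // => a _; rewrite ffunE mul0r.
Qed.

Lemma hessian0l u : TT y u -> H 0 u = 0.
Proof.
move=> TTu; have [_ Hlin _] := rescaled_hessian.
have := Hlin (-1) 0 0 u rescaled_TT0 rescaled_TT0 TTu.
by rewrite scaler0 addr0 mulN1r addNr.
Qed.

Lemma rescaled_unstable : G_unstable v0 y.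
Proof.
exists H; first exact: rescaled_hessian.
exists (pos_embed (const_mx 1)); first exact: rescaled_TT_wpar.
rewrite ltNge; apply/negP => /hessian_pos_embed/rowP/(_ (inord 0)).
by rewrite !mxE => /eqP; rewrite oner_eq0.
Qed.

Definition pos_coord (u : coeffs R 5) : 'rV[R]_5 :=
  \row_i (nth 0 [:: par_b (log_deriv y u); par_c (log_deriv y u);
    par_s (log_deriv y u); par_t3 (log_deriv y u); par_t4 (log_deriv y u)] i).

Lemma pos_coord_linear : linear pos_coord.
Proof.
move=> a u v; apply/rowP => i; rewrite !mxE.
elim/ord5_ind: i; rewrite !inordK //= /par_t3 /par_t4 /par_b /par_c /par_s !log_derivP;
  by field.
Qed.

(** The image of [pos_embed] is positive of dimension 5. Conversely, the kernel of [pos_coord] on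
    the tangent space is the -1 eigenspace of J, where H is nonpositive, so [pos_coord] embeds every
    positive subspace into dimension 5. *)
Lemma rescaled_coindex : has_coindex v0 y 5.
Proof.
exists H; first exact: rescaled_hessian.
pose f : {linear 'rV[R]_5 -> coeffs R 5} :=
  HB.pack pos_embed (GRing.isLinear.Build R _ _ *:%R pos_embed pos_embed_linear).
pose g : {linear coeffs R 5 -> 'rV[R]_5} :=
  HB.pack pos_coord (GRing.isLinear.Build R _ _ *:%R pos_coord pos_coord_linear).
split.
  exists (limg (linfun f)).
    move=> v /memv_imgP[r _ ->]; rewrite lfunE; split; first exact: rescaled_TT_wpar.
    move=> fr0; rewrite ltNge; apply/negP => /hessian_pos_embed r0.
    by move: fr0; rewrite r0 linear0 eqxx.
  rewrite limg_dim_eq ?dimvf ?dim_matrix //.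
  have /lker0P/eqP -> : injective (linfun f); last by rewrite capv0.
  move=> r r'; rewrite !lfunE => e; apply/eqP; rewrite -subr_eq0; apply/eqP.
  apply: hessian_pos_embed; have -> : pos_embed (r - r') = 0.
    by rewrite -[pos_embed _]/(f (r - r')) linearB e subrr.
  by rewrite hessian0l //; exact: rescaled_TT0.
move=> U posU; apply: (@leq_trans (\dim {: 'rV[R]_5})); last first.
  by rewrite dimvf dim_matrix.
have <- : \dim (linfun g @: U) = \dim U; last exact/dimvS/subvf.
apply: limg_dim_eq; apply/eqP; rewrite -subv0; apply/subvP => v.
rewrite memv_cap memv_ker memv0 => /andP[vU]; rewrite lfunE => /eqP/rowP gv.
have [TTv v_pos] := posU _ vU.
apply: contraT => /v_pos; rewrite ltNge => /negP[].
have cE i : (i < 5)%N -> pos_coord v 0 (inord i) = 0 by move=> _; rewrite gv mxE.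
have /= := cE 0%N isT; have /= := cE 1%N isT; have /= := cE 2%N isT.
have /= := cE 3%N isT; have /= := cE 4%N isT; rewrite !mxE !inordK //= => t40 t30 s0 c0 b0.
have [g3 [g4 [o3 [o4 vE]]]] := rescaled_TT_wpar_surj TTv.
rewrite b0 c0 s0 t30 t40 in vE.
(* Here J v = -v, so H(v, v) = -H(v, J v) is nonpositive, against the positivity on [U]. *)
have neg : from_log y (wpar 0 0 0 0 0 (- g3) (- g4) (- o3) (- o4)) = - v.
  rewrite vE; apply/ffunP => a; rewrite [RHS]ffunE.
  have e w : from_log y w a = (y a : R) * w (fst_ix a) (snd_ix a) by rewrite [LHS]ffunE.
  rewrite !e -[RHS]mulrN; congr (_ * _).
  have := @wpar_linear R (-1) 0 0 0 0 0 g3 g4 o3 o4 0 0 0 0 0 0 0 0 0 (fst_ix a) (snd_ix a).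
  by rewrite wpar0 !mulr0 !addr0 !mulN1r.
have [Hsym Hlin _] := rescaled_hessian.
have TTN : TT y (- v) by rewrite -neg; exact: rescaled_TT_wpar.
have HN : H v (- v) = - H v v.
  have := Hlin (-1) v 0 v TTv rescaled_TT0 TTv.
  by rewrite addr0 scaleN1r mulN1r (hessian0l TTv) addr0 -Hsym.
have := hessian_pairing_lower 0 0 0 0 0 g3 g4 o3 o4.
rewrite neg -vE HN => hle; rewrite -oppr_ge0; apply: le_trans hle.
by rewrite !mulr_ge0 ?addr_ge0 ?sqr_ge0 ?invr_ge0 // ltW.
Qed.

End Index.

Theorem proposition8p6 (R : realType) (v0 : R) (hv0 : 0 < v0) :
  (exists! K : R, 0 < K /\ cubic K = 0) /\
  (forall K : R, 0 < K -> cubic K = 0 ->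
     `|K - (7 + 4806 / 10 ^+ 4)| < 1 / (2 * 10 ^+ 4) /\
     (exists2 rho : R, 2 * rho = 1 / 10 & einstein (g3 K) rho) /\
     (exists2 y, unit_rescaling v0 (g3 K) y &
        [/\ G_nondegenerate v0 y, G_unstable v0 y & has_coindex v0 y 5])).
Proof.
split.
  have [K K_gt0 K_root] := @cubic_exists R.
  by exists K; split=> // x [_ x_root]; exact: cubic_unique.
move=> K K_gt0 K_root; split; last split.
- have /andP[K1 K2] := cubic_bounds K_root.
  by rewrite ltr_norml; apply/andP; split; lra.
- exists (1 / 20); first by field.
  apply: einsteinP; first exact: g3_metric.
  by move=> a; apply: g3_ricci => //; exact: neq_pair.
have a0 : pairs 5 by exists (inord 0, inord 1); rewrite /= !inordK.
have [k k_gt0 vol1] := unit_rescaling_exists a0 hv0 (g3_metric K_root).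
exists (k *: g3 K); first by split=> //; exists k.
split; [exact: rescaled_nondegenerate | exact: rescaled_unstable | exact: rescaled_coindex].
Qed.
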